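(* Let $Z$ be a Banach space. The following are equivalent. (a) $Z$ has the Radon-Nikodým property. (b) For every Banach space $Y$ and every equivalent renorming $Z'$ of $Z$, $\mathrm{QNA}(Z',Y)$ is dense in $\mathcal{L}(Z',Y)$. (c) For every Banach space $X$ and every equivalent renorming $Z'$ of $Z$, $\mathrm{QNA}(X,Z')$ is dense in $\mathcal{L}(X,Z')$.
   Context: Banach spaces are over $\mathbb{K}=\mathbb{R}$ or $\mathbb{C}$; $B_X$ is the closed unit ball of $X$; $\mathcal{L}(X,Y)$ is the space of bounded linear operators with the operator norm. $T\in\mathcal{L}(X,Y)$ is quasi norm attaining, $T\in\mathrm{QNA}(X,Y)$, if there is $u\in\overline{T(B_X)}$ (norm closure) with $\|u\|=\|T\|$. An equivalent renorming of $Z$ is the vector space $Z$ endowed with a norm equivalent to the original one. A Banach space has the Radon-Nikodým property (RNP) if every nonempty bounded subset of it is dentable, where a set $A$ is dentable if for every $\delta>0$ there is $a\in A$ not belonging to the closed convex hull of $A\setminus\{b:\|b-a\|<\delta\}$. *)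

(* Defs.v *)
From HB Require Import structures.
From mathcomp Require Import all_boot all_order all_algebra.
From mathcomp Require Import complex.
From mathcomp Require Import boolp classical_sets functions interval_inference.
From mathcomp Require Import reals topology normedtype convex.

Set Implicit Arguments.
Unset Strict Implicit.
Unset Printing Implicit Defensive.

Import Order.TTheory GRing.Theory Num.Theory.
Import numFieldNormedType.Exports.

Local Open Scope classical_set_scope.
Local Open Scope ring_scope.

Inductive scalars := RealScalars | ComplexScalars.

Definition scalar_field (R : realType) (k : scalars) : numFieldType :=
  match k with
  | RealScalars => R
  | ComplexScalars => R[i]
  end.

Definition unit_ball (K : numFieldType) (V : normedModType K) : set V :=
  [set x | `|x| <= 1].

Arguments unit_ball {K} V.

Section Operators.
Variables (K : numFieldType) (X Y : normedModType K).

Definition bounded_operators : set {linear X -> Y} :=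
  [set T | bounded_near T (nbhs (0 : X))].

(* The norm takes its values in K, so the least upper bound is taken for the
   order of K. When K is R[i], any upper bound of a nonempty set of nonnegative
   elements is real, so this is the supremum in R (for K = R it is sup). *)
Definition opnorm (f : X -> Y) : K :=
  supremum 0 [set `|f x| | x in unit_ball X].

Definition QNA : set {linear X -> Y} :=
  [set T | bounded_operators T /\
     exists2 u : Y, closure (T @` unit_ball X) u & `|u| = opnorm T].

Definition dense_operators (D : set {linear X -> Y}) : Prop :=
  forall T, bounded_operators T ->
  forall e : K, 0 < e -> exists2 S, D S & opnorm (T \- S) < e.

End Operators.

Arguments QNA {K} X Y.

Section RadonNikodym.
Variables (K : numFieldType) (Z : normedModType K).

Definition closed_convex_hull (A : set Z) : set Z :=
  smallest [set C : set Z | closed C /\ convex_set C] A.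

Definition dentable (A : set Z) : Prop :=
  forall d : K, 0 < d -> exists2 a, A a &
    ~ closed_convex_hull (A `\` [set b | `|b - a| < d]) a.

Definition RNP : Prop :=
  forall A : set Z, A !=set0 -> bounded_set A -> dentable A.

End RadonNikodym.

Arguments RNP {K} Z.

Record equivalent_norm (K : numFieldType) (Z : normedModType K) := EquivalentNorm {
  en_norm :> Z -> K;
  en_normD : forall x y, en_norm (x + y) <= en_norm x + en_norm y;
  en_normZ : forall (l : K) x, en_norm (l *: x) = `|l| * en_norm x;
  en_norm0_eq0 : forall x, en_norm x = 0 -> x = 0;
  en_equiv : exists c C : K, [/\ 0 < c, 0 < C &
    forall x, c * `|x| <= en_norm x /\ en_norm x <= C * `|x| ]
}.

(* The vector space Z with the norm N; its topology and uniformity are those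
   induced by N. *)
Definition renorming (K : numFieldType) (Z : normedModType K)
  (N : equivalent_norm Z) : Type := Z.

HB.instance Definition _ (K : numFieldType) (Z : normedModType K)
    (N : equivalent_norm Z) :=
  GRing.Lmodule.copy (renorming N) Z.
HB.instance Definition _ (K : numFieldType) (Z : normedModType K)
    (N : equivalent_norm Z) :=
  Lmodule_isNormed.Build K (renorming N)
    (@en_normD K Z N) (@en_normZ K Z N) (@en_norm0_eq0 K Z N).

Lemma renorming_normE (K : numFieldType) (Z : normedModType K)
  (N : equivalent_norm Z) (x : renorming N) : `|x| = N x.
Proof. by []. Qed.

Lemma renorming_complete (K : numFieldType) (Z : completeNormedModType K)
  (N : equivalent_norm Z) (F : set_system (renorming N)) :
  ProperFilter F -> cauchy F -> cvg F.
Proof.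
move=> FF /cauchy_ballP cF.
have [c [C [c0 C0 NP]]] := en_equiv N.
pose G : set_system Z := F.
have GF : ProperFilter G by exact: FF.
have cG : cauchy G.
  apply/cauchy_ballP => e e0.
  have := cF (c * e) (mulr_gt0 c0 e0).
  apply: filterS => -[x y]; rewrite -!ball_normE /= => xy.
  rewrite -(ltr_pM2l c0).
  by apply: le_lt_trans xy; case: (NP (x - y)).
have [l] := (cvg_ex G).1 (cauchy_cvg G cG); move=> /cvgrPdist_lt Gl.
apply/(cvg_ex F); exists l; apply/(@cvgrPdist_lt _ (renorming N)) => e e0.
have e1 : 0 < C^-1 * e by rewrite mulr_gt0// invr_gt0.
apply: filterS (Gl _ e1) => x /= lx.
rewrite renorming_normE; have [_ /le_lt_trans] := NP (l - x); apply.
by rewrite -ltr_pdivlMl.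
Qed.

HB.instance Definition _ (K : numFieldType) (Z : completeNormedModType K)
    (N : equivalent_norm Z) :=
  Uniform_isComplete.Build (renorming N) (@renorming_complete K Z N).

(* Main.v *)
Require Import Defs.
From HB Require Import structures.
From mathcomp Require Import all_boot all_order all_algebra.
From mathcomp Require Import boolp classical_sets functions.
From mathcomp Require Import reals topology normedtype.
From mathcomp Require Import complex convex interval_inference ring lra.
Set Implicit Arguments.
Unset Strict Implicit.
Unset Printing Implicit Defensive.
Import Order.TTheory GRing.Theory Num.Theory.
Import numFieldNormedType.Exports.
Local Open Scope classical_set_scope.
Local Open Scope ring_scope.

(** For (a) => (b), (c): if [Z] has the RNP, [D] is a bounded subset of [Z] and
    [h] is Lipschitz, there is an arbitrarily small functional [g] such that
    [h + Re g] attains its supremum over [D] at a point [z] of the closure of [D]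
    (Stegall's variational principle). Write an operator as [T2 o T1] through
    [Z], with [D = T1 (B_X)] and [h = |T2 .|]; then [T2 o T1 + g (T1 .) u], for a
    unit vector [u] aligned with [T2 z], is quasi norm attaining.

    Conversely, let [A] be a bounded set which is not dentable; it may be taken
    countable, [A = {x_i}]. Let [C] be its closed absolutely convex hull, all of
    whose slices are large. By induction on the number of balls, [C] is the
    closed convex hull of what remains when finitely many small balls are
    removed. Give [Z] the norm with unit ball [C + r B] on one side, and the norm
    [|.| + sum_n c_n p_n] on the other side, where [p_n] is the seminorm obtained
    from the norm by making [x_0, ..., x_(n-1)] short. No operator near the
    identity between these two spaces is quasi norm attaining. *)

(** * Elementary facts on real numbers: geometric decay and finite nets *)

Lemma geom_small (R : realType) (C e : R) : 0 < e -> exists n, C * 2^-1 ^+ n < e.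
Proof.
move=> e0; exists (Num.bound (C / e)).
rewrite exprVn ltr_pdivrMr ?exprn_gt0 // mulrC -ltr_pdivrMr //.
exact: upper_nthrootP.
Qed.

Lemma real_net (R : realType) (B m : R) : 0 < m ->
  exists s : seq R, forall c, `|c| <= B -> exists2 b, b \in s & `|c - b| <= m.
Proof.
move=> m0.
have net n : exists s : seq R, forall c, 0 <= c <= n%:R * m ->
    exists2 b, b \in s & `|c - b| <= m.
  elim: n => [|n [s sP]].
    exists [:: 0] => c; rewrite mul0r => c0; exists 0; first by rewrite inE.
    by have -> : c = 0; [lra|rewrite subrr normr0 ltW].
  exists (n%:R * m :: s) => c; rewrite -natr1 mulrDl mul1r => cn.
  have [cm|mc] := leP c (n%:R * m).
    by have [|b sb cb] := sP c; [lra|exists b; rewrite ?inE ?sb ?orbT].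
  exists (n%:R * m); first by rewrite inE eqxx.
  by rewrite ger0_norm; lra.
(* A net of step [m] on an interval starting at 0 and longer than [2 * |B|], shifted by [- B],
   covers the whole range from [- B] to [B]. *)
have [s sP] := net (Num.bound (2 * `|B| / m)).
exists [seq b - B | b <- s] => c cB.
have [|b sb cb] := sP (c + B).
  have /ltW : 2 * `|B| / m < (Num.bound (2 * `|B| / m))%:R.
    by rewrite archi_boundP // divr_ge0 ?mulr_ge0 // ltW.
  rewrite ler_pdivrMr //; have := ler_norm B; move: cB; rewrite ler_norml; lra.
exists (b - B); first by apply/mapP; exists b.
by rewrite opprB addrA.
Qed.

(** * Real-valued norms over both scalar fields *)

Section Scalars.
Variables (R : realType) (k : scalars).
Local Notation K := (scalar_field R k).

(** Norms take values in [K], possibly in the complex numbers. [io] and [re] move them to and from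
    [R], where the order is total and all estimates are made. *)
Definition io : R -> K :=
  match k return R -> scalar_field R k with
  | RealScalars => fun r => r
  | ComplexScalars => fun r => Complex r 0
  end.

Definition re : K -> R :=
  match k return scalar_field R k -> R with
  | RealScalars => fun z => z
  | ComplexScalars => fun z => complex.Re z
  end.

Lemma ioK : cancel io re.
Proof. by rewrite /re /io; case: k. Qed.

Lemma ioD a b : io (a + b) = io a + io b.
Proof. by rewrite /io; case: k => //=; apply/eqP; rewrite eq_complex /= addr0 !eqxx. Qed.

Lemma ioM a b : io (a * b) = io a * io b.
Proof.
rewrite /io; case: k => //=; apply/eqP.
by rewrite eq_complex /= !(mulr0, mul0r) subr0 addr0 !eqxx.
Qed.

Lemma io0 : io 0 = 0.
Proof. by rewrite /io; case: k. Qed.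

Lemma io1 : io 1 = 1.
Proof. by rewrite /io; case: k. Qed.

Lemma ioN a : io (- a) = - io a.
Proof. by apply/eqP; rewrite -addr_eq0 -ioD addNr io0. Qed.

Lemma ioB a b : io (a - b) = io a - io b.
Proof. by rewrite ioD ioN. Qed.

Lemma ler_io a b : (io a <= io b) = (a <= b).
Proof. by rewrite /io; case: k => //=; rewrite lecE /= eqxx. Qed.

Lemma ltr_io a b : (io a < io b) = (a < b).
Proof. by rewrite /io; case: k => //=; rewrite ltcE /= eqxx. Qed.

Lemma re0 : re 0 = 0.
Proof. by rewrite /re; case: k. Qed.

Lemma io_re_ge0 a : 0 <= a -> io (re a) = a.
Proof.
move: a; rewrite /re /io; case: k => //= -[a b]; rewrite lecE /= => /andP[/eqP -> _].
by [].
Qed.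

Lemma gt0_ioP a : 0 < a -> exists2 r, 0 < r & a = io r.
Proof. by move=> a0; exists (re a); [rewrite -ltr_io io0|]; rewrite io_re_ge0 // ltW. Qed.

Lemma io_norm r : `|io r| = io `|r|.
Proof.
rewrite /io; case: k => //; have := normc_def (Complex r 0).
by rewrite /= expr0n /= addr0 sqrtr_sqr.
Qed.

Definition nr (a : K) : R := re `|a|.

Lemma io_nr a : io (nr a) = `|a|.
Proof. by rewrite io_re_ge0. Qed.

Lemma nr_io r : nr (io r) = `|r|.
Proof. by rewrite /nr io_norm ioK. Qed.

Lemma re_le_nr a : re a <= nr a.
Proof.
move: a; rewrite /nr /re; case: k => a; first exact: ler_norm.
have := normc_def (a : R[i]) => /(congr1 (@complex.Re R)) /= ->.
apply: le_trans (ler_norm _) _.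
by rewrite -sqrtr_sqr ler_sqrt ?addr_ge0 ?sqr_ge0 // lerDl sqr_ge0.
Qed.

Lemma nr_ge0 a : 0 <= nr a.
Proof. by rewrite -ler_io io_nr io0. Qed.

Lemma nrM a b : nr (a * b) = nr a * nr b.
Proof. by apply: (can_inj ioK); rewrite ioM !io_nr normrM. Qed.

Lemma nr0_eq0 a : nr a = 0 -> a = 0.
Proof. by move=> a0; apply/eqP; rewrite -normr_eq0 -io_nr a0 io0. Qed.

Lemma nr0 : nr 0 = 0.
Proof. by rewrite /nr normr0 re0. Qed.

Lemma nrV a : nr a^-1 = (nr a)^-1.
Proof.
have [->|a0] := eqVneq a 0; first by rewrite invr0 nr0 invr0.
have na0 : nr a != 0 by apply: contra_neq a0; exact: nr0_eq0.
by apply: (mulIf na0); rewrite -nrM mulVf // mulVf // /nr normr1 -io1 ioK.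
Qed.

Lemma nr1 : nr 1 = 1.
Proof. by rewrite /nr normr1 -io1 ioK. Qed.

Lemma rotation a : exists2 c, nr c = 1 & c * a = io (nr a).
Proof.
have [->|a0] := eqVneq a 0; first by exists 1; rewrite ?nr1 // nr0 io0 mulr0.
exists (`|a| / a); last by rewrite divfK // io_nr.
have na0 : nr a != 0 by apply: contra_neq a0; exact: nr0_eq0.
by rewrite nrM nrV -io_nr nr_io ger0_norm ?nr_ge0 // divff.
Qed.

Lemma scalar_net (B m : R) : 0 < m ->
  exists s : seq K, forall c, nr c <= B -> exists2 b, b \in s & nr (c - b) <= m.
Proof.
rewrite /nr /re; case: k => m0; first exact: real_net.
(* Complex case: a product of two real nets. Mesh [m / 2] in each coordinate leaves an error of at
   most [m / sqrt 2]. *)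
have [s sP] := @real_net R B (m / 2) (divr_gt0 m0 (ltr0Sn _ _)).
have normE (x y : R) : complex.Re `|Complex x y : R[i]| = Num.sqrt (x ^+ 2 + y ^+ 2).
  by rewrite normc_def.
exists [seq Complex a b | a <- s, b <- s] => -[x y] /= xyB'.
have xyB : Num.sqrt (x ^+ 2 + y ^+ 2) <= B by rewrite -normE.
have [xB yB] : `|x| <= B /\ `|y| <= B.
  split; apply: le_trans xyB; rewrite -sqrtr_sqr ler_sqrt ?addr_ge0 ?sqr_ge0 //.
    by rewrite lerDl sqr_ge0.
  by rewrite lerDr sqr_ge0.
have [a sa xa] := sP _ xB; have [b sb yb] := sP _ yB.
exists (Complex a b); first by apply/allpairsP; exists (a, b).
suff : Num.sqrt ((x - a) ^+ 2 + (y - b) ^+ 2) <= m by rewrite -normE.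
rewrite -(ler_sqr (sqrtr_ge0 _)) ?nnegrE ?ltW // sqr_sqrtr ?addr_ge0 ?sqr_ge0 //.
rewrite -[(x - a) ^+ 2]real_normK ?num_real // -[(y - b) ^+ 2]real_normK ?num_real //.
have := normr_ge0 (x - a); have := normr_ge0 (y - b).
by move: `|x - a| xa `|y - b| yb => u u1 v v1 u0 v0; nra.
Qed.

Section Normed.
Variable V : normedModType K.
Implicit Types (x y : V).

Definition nrm x : R := re `|x|.

Lemma io_nrm x : io (nrm x) = `|x|.
Proof. by rewrite io_re_ge0. Qed.

Lemma nrm_ge0 x : 0 <= nrm x.
Proof. by rewrite -ler_io io_nrm io0. Qed.

Lemma nrmD x y : nrm (x + y) <= nrm x + nrm y.
Proof. by rewrite -ler_io ioD !io_nrm ler_normD. Qed.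

Lemma nrmZ a x : nrm (a *: x) = nr a * nrm x.
Proof. by apply: (can_inj ioK); rewrite ioM io_nr !io_nrm normrZ. Qed.

Lemma nrm0_eq0 x : nrm x = 0 -> x = 0.
Proof. by move=> x0; apply/eqP; rewrite -normr_eq0 -io_nrm x0 io0. Qed.

Lemma nrm0 : nrm 0 = 0.
Proof. by rewrite /nrm normr0 re0. Qed.

Lemma nrmN x : nrm (- x) = nrm x.
Proof. by rewrite /nrm normrN. Qed.

Lemma nrm_distC x y : nrm (x - y) = nrm (y - x).
Proof. by rewrite /nrm distrC. Qed.

Lemma nrm_triangle z x y : nrm (x - y) <= nrm (x - z) + nrm (z - y).
Proof. by have := nrmD (x - z) (z - y); rewrite addrA subrK. Qed.

Lemma closureP (A : set V) u :
  closure A u <-> forall e : R, 0 < e -> exists2 a, A a & nrm (u - a) < e.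
Proof.
split=> [cA e e0|cA B /nbhs_ballP [e e0 eB]].
  have [|a [Aa]] := cA (ball u (io e)).
    by apply: nbhsx_ballx; rewrite -io0 ltr_io.
  by rewrite -ball_normE /= -io_nrm ltr_io; exists a.
have [d d0 ed] := gt0_ioP e0; have [a Aa ua] := cA d d0; exists a; split=> //.
by apply: eB; rewrite -ball_normE /= ed -io_nrm ltr_io.
Qed.

(** Closedness and convexity are restated with real parameters, so that hulls can be handled without
    filters or the interval type. *)
Definition eclosed (C : set V) :=
  forall u, (forall e : R, 0 < e -> exists2 a, C a & nrm (u - a) < e) -> C u.

Definition econvex (C : set V) := forall x y t,
  C x -> C y -> 0 <= t <= 1 -> C (io t *: x + io (1 - t) *: y).

Lemma closedP (C : set V) : closed C <-> eclosed C.
Proof.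
split=> [cC u uC|cC u /closureP]; last exact: cC.
by apply: cC; apply/closureP.
Qed.

Lemma convexP (C : set V) : convex_set C <-> econvex C.
Proof.
split=> [cC x y t Cx Cy /andP[t0 t1]|cC x y p xC yC].
  have t0' : 0 <= io t by rewrite -io0 ler_io.
  have t1' : io t <= 1 by rewrite -io1 ler_io.
  have := cC x y (Itv01 t0' t1'); rewrite !inE => /(_ Cx Cy).
  by rewrite /conv /= ioB io1.
have : C (p%:num *: (x : V) + (1 - p%:num) *: (y : V)); last by rewrite inE.
have p0 : 0 <= p%:num by [].
have p1 : p%:num <= 1 by [].
move: (p%:num) p0 p1 => q q0 q1; move: xC yC; rewrite !in_setE => xC yC.
rewrite -(io_re_ge0 q0) -io1 -ioB; apply: cC => //.
by rewrite -!ler_io io_re_ge0 // io0 io1 q0 q1.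
Qed.

Definition hull (A : set V) : set V := fun z =>
  forall C : set V, eclosed C -> econvex C -> A `<=` C -> C z.

Lemma hullE (A : set V) : closed_convex_hull A = hull A.
Proof.
apply/seteqP; split=> z zA C.
  move=> /closedP cC /convexP cvC AC; apply: zA; split=> //.
by move=> [[/closedP cC /convexP cvC] AC]; exact: zA.
Qed.

Lemma bounded_setP (A : set V) :
  bounded_set A <-> exists2 M, 0 < M & forall x, A x -> nrm x <= M.
Proof.
split=> [/pinfty_ex_gt0 [M M0 AM]|[M M0 AM]].
  have [r r0 Mr] := gt0_ioP M0; exists r => // x /AM /=.
  by rewrite Mr -io_nrm ler_io.
exists (io M); split; first by apply: ger0_real; rewrite -io0 ler_io ltW.
move=> r Mr x /AM xM; apply: le_trans (ltW Mr).
by rewrite -io_nrm ler_io.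
Qed.

End Normed.

(** The sequences built in the variational principle are geometrically Cauchy. Keeping the rate in
    the conclusion replaces limits by inequalities valid for every [n]. *)
Lemma complete_geom (V : completeNormedModType K) (u : nat -> V) (C : R) :
  (forall n m, (n <= m)%N -> nrm (u m - u n) <= C * 2^-1 ^+ n) ->
  exists l, forall n, nrm (u n - l) <= C * 2^-1 ^+ n.
Proof.
move=> uC.
have cu : cauchy (u @ \oo).
  apply/cauchy_exP => e /gt0_ioP[d d0 ->]; have [n nd] := geom_small C d0.
  exists (u n); exists n => // m /= nm; rewrite -ball_normE /= -io_nrm ltr_io.
  by rewrite nrm_distC; apply: le_lt_trans (uC _ _ nm) nd.
have [l /cvgrPdist_lt ul] := (cvg_ex _).1 (cauchy_cvg _ cu); exists l => n.
apply/ler_addgt0Pr => e e0; have e0' : 0 < io e by rewrite -io0 ltr_io.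
have [N _ Nl] := ul _ e0'; have := Nl (maxn n N) (leq_maxr _ _).
rewrite /= -io_nrm ltr_io => lN; apply: le_trans (nrm_triangle (u (maxn n N)) _ _) _.
apply: lerD; last by rewrite nrm_distC ltW.
by rewrite nrm_distC; apply: uC; exact: leq_maxl.
Qed.

Lemma bounded_operatorsP (X Y : normedModType K) (T : {linear X -> Y}) :
  bounded_operators T <-> exists2 M, 0 <= M & forall x, nrm (T x) <= M * nrm x.
Proof.
split=> [/linear_boundedP /pinfty_ex_gt0 [M M0 TM]|[M M0 TM]].
  have [r r0 Mr] := gt0_ioP M0; exists r => [|x]; first exact: ltW.
  by rewrite -ler_io ioM !io_nrm -Mr.
apply/linear_boundedP; exists (io M); split; first by apply: ger0_real; rewrite -io0 ler_io.
move=> r Mr x; apply: (@le_trans _ _ (io M * `|x|)); first by rewrite -!io_nrm -ioM ler_io.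
by rewrite ler_wpM2r // ltW.
Qed.

(** The order of [K] may be partial, but every upper bound of the norms dominates the norm of [f 0],
    hence is nonnegative and real. The real supremum is therefore also the least upper bound in
    [K]. *)
Lemma opnormP (X Y : normedModType K) (f : X -> Y) (M : R) :
  (forall x, nrm x <= 1 -> nrm (f x) <= M) ->
  exists m, [/\ opnorm f = io m, (forall x, nrm x <= 1 -> nrm (f x) <= m) &
    forall b, (forall x, nrm x <= 1 -> nrm (f x) <= b) -> m <= b].
Proof.
move=> fM.
pose S : set R := [set nrm (f x) | x in [set x | nrm x <= 1]].
have S0 : S !=set0 by exists (nrm (f 0)), 0 => //=; rewrite nrm0.
have hS : has_sup S by split=> //; exists M => _ [x /= x1 <-]; exact: fM.
have fm x : nrm x <= 1 -> nrm (f x) <= sup S.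
  by move=> x1; apply: ub_le_sup; [case: hS|exists x].
have ml b : (forall x, nrm x <= 1 -> nrm (f x) <= b) -> sup S <= b.
  move=> fb; apply: ge_sup => //; move=> _ [x x1 <-]; exact: fb.
exists (sup S); split=> //.
rewrite /opnorm /supremum; set A := (X in if X == _ then _ else _).
have Af x : nrm x <= 1 -> A `|f x| by exists x => //=; rewrite /unit_ball /= -io_nrm -io1 ler_io.
have mA : supremums A (io (sup S)).
  split.
    move=> y [x x1 <-]; move: x1; rewrite /unit_ball /= -io_nrm -io1 ler_io => x1.
    by rewrite -io_nrm ler_io; exact: fm.
  move=> b bA; have b0 : 0 <= b by apply: le_trans (bA `|f 0| _); [|apply: Af; rewrite nrm0].
  rewrite -(io_re_ge0 b0) ler_io; apply: ml => x x1.
  by rewrite -ler_io io_nrm io_re_ge0 //; apply: bA; exact: Af.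
have -> : (A == set0) = false.
  by apply/negbTE/set0P; exists `|f 0|; apply: Af; rewrite nrm0.
by case: xgetP => [y -> yA|/(_ _ mA) //]; apply: is_subset1_supremums yA mA.
Qed.

End Scalars.

(** Combined with [choice], this defines functionals as pointwise infima that are known only through
    their two characteristic inequalities. *)
Lemma inf_family (R : realType) (I : Type) (P : set I) (f : I -> R) (b : R) :
  P !=set0 -> (forall i, P i -> b <= f i) ->
  exists m, (forall i, P i -> m <= f i) /\ (forall c, (forall i, P i -> c <= f i) -> c <= m).
Proof.
move=> [i0 Pi0] bf; exists (inf [set f i | i in P]); split=> [i Pi|c cf].
  by apply: ge_inf; [exists b => _ [j Pj <-]; exact: bf|exists i].
by apply: lb_le_inf; [exists (f i0), i0|move=> _ [j Pj <-]; exact: cf].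
Qed.

Lemma sup_family (R : realType) (I : Type) (P : set I) (f : I -> R) (b : R) :
  P !=set0 -> (forall i, P i -> f i <= b) ->
  exists m, (forall i, P i -> f i <= m) /\ (forall c, (forall i, P i -> f i <= c) -> m <= c).
Proof.
move=> P0 fb; have [|m [mf mm]] := @inf_family R I P (fun i => - f i) (- b) P0.
  by move=> i Pi; rewrite lerN2 fb.
exists (- m); split=> [i /mf|c fc]; first lra.
suff : - c <= m by lra.
by apply: mm => i /fc; lra.
Qed.

(** * Separation of points from closed convex sets *)

Section HahnBanach.
Variables (R : realType) (k : scalars).
Local Notation K := (scalar_field R k).
Local Notation io := (@io R k).

Section Sublinear.
Variable V : lmodType K.
Implicit Types (p q g : V -> R).

Definition rlinear g :=
  (forall x y, g (x + y) = g x + g y) /\ (forall t x, g (io t *: x) = t * g x).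

Definition sublinear p :=
  (forall x y, p (x + y) <= p x + p y) /\ (forall s x, 0 < s -> p (io s *: x) <= s * p x).

Lemma sublinearZ p s x : sublinear p -> 0 < s -> p (io s *: x) = s * p x.
Proof.
move=> [_ pZ] s0; apply/eqP; rewrite eq_le pZ //=.
have := pZ s^-1 (io s *: x); rewrite invr_gt0 scalerA -ioM mulVf ?gt_eqF // io1 scale1r => /(_ s0).
by rewrite -ler_pdivrMl ?invr_gt0 // invrK.
Qed.

Lemma sublinear0 p : sublinear p -> p 0 = 0.
Proof. by move=> sp; have := @sublinearZ p 2 0 sp (ltr0Sn _ _); rewrite scaler0; lra. Qed.

Lemma sublinear_ge p x : sublinear p -> - p (- x) <= p x.
Proof.
by move=> sp; have [pD _] := sp; have := pD x (- x); rewrite subrr sublinear0 //; lra.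
Qed.

(** Zorn's lemma for the pointwise order. A nonempty chain is bounded below by its pointwise
    infimum, finite because members are at least [- p (- x)]. The infimum is subadditive because, of
    two members of the chain, the smaller one can be used at both points. *)
Lemma minimal_sublinear p : sublinear p -> exists q, [/\ sublinear q, (forall x, q x <= p x) &
  forall q', sublinear q' -> (forall x, q' x <= q x) -> forall x, q' x = q x].
Proof.
move=> sp; pose T := {q : V -> R | sublinear q /\ forall x, q x <= p x}.
pose le (s t : T) := `[< forall x, sval t x <= sval s x >].
have [|||A tA|t tmin] := @Zorn T le.
- by move=> t; apply/asboolP.
- by move=> r s t /asboolP rs /asboolP st; apply/asboolP => x; apply: le_trans (rs x).
- move=> [s Ps] [t Pt] /asboolP st /asboolP ts; apply: eq_exist; apply/funext => x.
  by apply/eqP; rewrite eq_le (st x) (ts x).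
- have [[t0 At0]|A0] := pselect (A !=set0); last first.
    by exists (exist _ p (conj sp (fun x => lexx _))) => s As; case: A0; exists s.
  have /choice [q qP] x : exists m, (forall t, A t -> m <= sval t x) /\
      (forall c, (forall t, A t -> c <= sval t x) -> c <= m).
    apply: (@inf_family _ _ A (fun t => sval t x) (- p (- x))); first by exists t0.
    case=> t [st tp] _ /=; apply: le_trans (sublinear_ge x st).
    by rewrite lerN2 tp.
  have sq : sublinear q.
    split=> [x y|s x s0].
      rewrite -lerBlDr; apply: (qP x).2 => t1 At1; rewrite lerBlDr -lerBlDl.
      apply: (qP y).2 => t2 At2; rewrite lerBlDl.
      have [/asboolP t12|/asboolP t21] := tA t1 t2 At1 At2.
        have [[t2D _] _] := svalP t2.
        by apply: le_trans ((qP _).1 _ At2) _; apply: le_trans (t2D x y) _; rewrite lerD2r t12.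
      have [[t1D _] _] := svalP t1.
      by apply: le_trans ((qP _).1 _ At1) _; apply: le_trans (t1D x y) _; rewrite lerD2l t21.
    rewrite -ler_pdivrMl //; apply: (qP x).2 => t At; rewrite ler_pdivrMl //.
    by apply: le_trans ((qP _).1 _ At) _; have [[_ tZ] _] := svalP t; exact: tZ.
  have qp x : q x <= p x by apply: le_trans ((qP x).1 _ At0) _; case: (svalP t0).
  by exists (exist _ q (conj sq qp)) => s As; apply/asboolP => x; exact: (qP x).1.
have [st tp] := svalP t; exists (sval t); split=> // q sq qt x.
have qp y : q y <= p y by exact: le_trans (qt y) (tp y).
have <- // := tmin (exist _ q (conj sq qp)).
exact/asboolP.
Qed.

(* A minimal sublinear [q] is additive, because [q] cannot exceed the sublinear
   function [x |-> inf_(t >= 0) (q (x + t y) - t q y)] at any point. *)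
Lemma dominated_linear p : sublinear p -> exists g, rlinear g /\ forall x, g x <= p x.
Proof.
move=> /minimal_sublinear [q [sq qp qmin]]; exists q; split=> //.
have [qD qZ] := sq.
have qDE x y : q (x + y) = q x + q y.
  apply/eqP; rewrite eq_le qD /=.
  have /choice [r rP] z : exists m, (forall t, 0 <= t -> m <= q (z + io t *: y) - t * q y) /\
      (forall c, (forall t, 0 <= t -> c <= q (z + io t *: y) - t * q y) -> c <= m).
    apply: (@inf_family _ _ [set t | 0 <= t] (fun t => q (z + io t *: y) - t * q y) (- q (- z))).
      by exists 0 => /=.
    move=> t /=; rewrite le_eqVlt => /predU1P[<-|t0].
      by rewrite io0 scale0r addr0 mul0r subr0 sublinear_ge.
    have := qD (z + io t *: y) (- z); rewrite [z + _]addrC addrK sublinearZ //; lra.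
  have rq z : r z <= q z.
    by have := (rP z).1 0 (lexx _); rewrite io0 scale0r addr0 mul0r subr0.
  have sr : sublinear r.
    split=> [z w|s z s0].
      rewrite -lerBlDr; apply: (rP z).2 => t1 t10; rewrite lerBlDr -lerBlDl.
      apply: (rP w).2 => t2 t20; rewrite lerBlDl.
      apply: le_trans ((rP _).1 (t1 + t2) (addr_ge0 t10 t20)) _.
      have := qD (z + io t1 *: y) (w + io t2 *: y).
      rewrite addrACA -scalerDl -ioD; lra.
    rewrite -ler_pdivrMl //; apply: (rP z).2 => t t0; rewrite ler_pdivrMl //.
    apply: le_trans ((rP _).1 (s * t) (mulr_ge0 (ltW s0) t0)) _.
    by rewrite ioM -scalerA -scalerDr sublinearZ // mulrBr mulrA.
  have := (rP x).1 1 ler01; rewrite (qmin r) // io1 scale1r mul1r; lra.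
split=> // t x; have [t0|t0|->] := ltgtP t 0; first last.
- by rewrite io0 scale0r mul0r sublinear0.
- exact: sublinearZ.
- have := qDE (io t *: x) (io (- t) *: x).
  rewrite -scalerDl -ioD subrr io0 scale0r sublinear0 // (@sublinearZ _ (- t)) ?oppr_gt0 //; lra.
Qed.

Lemma rlinear0 g : rlinear g -> g 0 = 0.
Proof. by move=> [_ gZ]; rewrite -(scale0r 0) -io0 gZ mul0r. Qed.

Lemma rlinearN g x : rlinear g -> g (- x) = - g x.
Proof. by move=> rg; have := rg.1 x (- x); rewrite subrr rlinear0 //; lra. Qed.

Lemma rlinearB g x y : rlinear g -> g (x - y) = g x - g y.
Proof. by move=> rg; rewrite rg.1 rlinearN. Qed.

Lemma rlinear_zero : rlinear (fun=> 0).
Proof. by split=> *; rewrite ?addr0 ?mulr0. Qed.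

Lemma rlinearDZ g h t : rlinear g -> rlinear h -> rlinear (fun x => g x + t * h x).
Proof. by move=> [gD gZ] [hD hZ]; split=> *; rewrite ?gD ?hD ?gZ ?hZ; ring. Qed.

End Sublinear.

Section Separation.
Variable V : normedModType K.

(* [nrm e <= 1] with [g e] close to [1] says that [g] has norm one. *)
Lemma separation (H : set V) a : eclosed H -> econvex H -> ~ H a ->
  exists g D, [/\ rlinear g, forall x, g x <= nrm x, 0 < D,
    forall y, H y -> g y + D <= g a &
    H !=set0 -> forall h, 0 < h -> exists2 e, nrm e <= 1 & h * (1 - g e) <= D].
Proof.
move=> clH cvH Ha; have [H0|H0] := pselect (H !=set0); last first.
  exists (fun=> 0), 1; split=> //; [exact: rlinear_zero|exact: nrm_ge0|].
  by move=> y Hy; case: H0; exists y.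
have [D [DH Dmax]] := @inf_family _ _ H (fun y => nrm (a - y)) 0 H0 (fun y _ => nrm_ge0 _).
have D0 : 0 < D.
  rewrite ltNge; apply/negP => D0; apply/Ha/clH => e e0.
  apply: contrapT => He; suff : e <= D by lra.
  by apply: Dmax => y Hy; rewrite leNgt; apply/negP => aye; apply: He; exists y.
(* [D] is the distance from [a] to [H]. The infimum of [f z] over [P] is the largest sublinear
   function that is below the norm and at most [- D] on [y - a] for [y] in [H]; a linear functional
   below it separates. *)
pose f z (ty : R * V) := nrm (z - io ty.1 *: (ty.2 - a)) - ty.1 * D.
pose P := [set ty : R * V | 0 <= ty.1 /\ H ty.2].
have [y0 Hy0] := H0.
have /choice [p pP] z : exists m, (forall i, P i -> m <= f z i) /\
    (forall c, (forall i, P i -> c <= f z i) -> c <= m).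
  apply: (@inf_family _ _ P (f z) (- nrm z)); first by exists (0, y0); split=> /=.
  move=> [t y] [/= t0 Hy]; rewrite /f /=.
  have := nrmD (z - io t *: (y - a)) (- z); rewrite addrAC subrr add0r nrmN nrmN nrmZ.
  rewrite nr_io ger0_norm // nrm_distC.
  have := ler_wpM2l t0 (DH _ Hy); lra.
have pnrm z : p z <= nrm z.
  by have := (pP z).1 (0, y0); rewrite /f /= io0 scale0r !subr0 mul0r subr0; apply; split=> /=.
have sp : sublinear p.
  split=> [z w|s z s0].
    rewrite -lerBlDr; apply: (pP z).2 => -[t1 y1] [/= t10 Hy1]; rewrite lerBlDr -lerBlDl.
    apply: (pP w).2 => -[t2 y2] [/= t20 Hy2]; rewrite lerBlDl /f /=.
    (* Convexity of [H]: the cone generated by [H - a] is stable under sums, the coefficients adding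
       up. *)
    have [y Hy yE] : exists2 y, H y &
        io (t1 + t2) *: (y - a) = io t1 *: (y1 - a) + io t2 *: (y2 - a).
      have [t12|t12] := eqVneq (t1 + t2) 0.
        have [-> ->] : t1 = 0 /\ t2 = 0 by lra.
        by exists y0 => //; rewrite addr0 io0 !scale0r addr0.
      have t120 : 0 < t1 + t2 by rewrite lt_def t12 addr_ge0.
      exists (io (t1 / (t1 + t2)) *: y1 + io (1 - t1 / (t1 + t2)) *: y2).
        by apply: cvH => //; rewrite divr_ge0 ?(ltW t120) // ler_pdivrMr // mul1r lerDl.
      have -> : 1 - t1 / (t1 + t2) = t2 / (t1 + t2) by field.
      rewrite scalerBr scalerDr !scalerA -!ioM ![(t1 + t2) * _]mulrC !divfK //.
      by rewrite !scalerBr ioD scalerDl opprD addrACA.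
    apply: le_trans ((pP _).1 (t1 + t2, y) _) _; first by split=> //=; exact: addr_ge0.
    rewrite /f /= yE opprD addrACA.
    have := nrmD (z - io t1 *: (y1 - a)) (w - io t2 *: (y2 - a)); lra.
  rewrite -ler_pdivrMl //; apply: (pP z).2 => -[t y] [/= t0 Hy]; rewrite ler_pdivrMl //.
  apply: le_trans ((pP _).1 (s * t, y) _) _; first by split=> //=; rewrite mulr_ge0 // ltW.
  rewrite /f /= ioM -scalerA -scalerBr nrmZ nr_io gtr0_norm // mulrBr mulrA.
  by [].
have [g [rg gp]] := dominated_linear sp.
have ga y : H y -> g y + D <= g a.
  move=> Hy; have := le_trans (gp (y - a)) ((pP (y - a)).1 (1, y) (conj ler01 Hy)).
  by rewrite /f /= io1 scale1r subrr nrm0 mul1r (rlinearB _ _ rg); lra.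
exists g, D; split=> // [x|_ h h0]; first exact: le_trans (gp x) (pnrm x).
(* The unit vector along [a - y], for [y] almost nearest to [a], almost norms [g]. With [N] the norm
   of [a - y], the excess [D ^+ 2 / h] is what gives [h * (N - D) <= D ^+ 2 <= D * N]. *)
have [y Hy yD] : exists2 y, H y & nrm (a - y) < D + D ^+ 2 / h.
  apply: contrapT => He; suff : D + D ^+ 2 / h <= D.
    have : 0 < D ^+ 2 / h by rewrite divr_gt0 // exprn_gt0.
    by lra.
  by apply: Dmax => y Hy; rewrite leNgt; apply/negP => aye; apply: He; exists y.
have DN := DH _ Hy; have N0 : 0 < nrm (a - y) by exact: lt_le_trans DN.
exists (io (nrm (a - y))^-1 *: (a - y)).
  by rewrite nrmZ nr_io gtr0_norm ?invr_gt0 // mulVf // gt_eqF.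
rewrite rg.2 (rlinearB _ _ rg); have gD : D <= g a - g y by have := ga _ Hy; lra.
set N := nrm _ in DN yD N0 *.
have : h * (1 - N^-1 * D) <= D.
  have -> : h * (1 - N^-1 * D) = h * (N - D) / N by field; rewrite gt_eqF.
  rewrite ler_pdivrMr //; have -> : D * N = D * D + D * (N - D) by ring.
  have : (N - D) * h <= D ^+ 2 by rewrite -ler_pdivlMr //; lra.
  have : 0 <= D * (N - D) by rewrite mulr_ge0 ?subr_ge0 // ltW.
  by lra.
move=> hD; have NgD : N^-1 * D <= N^-1 * (g a - g y) by rewrite ler_pM2l ?invr_gt0.
have := ler_wpM2l (ltW h0) NgD; move: (N^-1 * D) (N^-1 * (g a - g y)) hD => u v; lra.
Qed.

End Separation.
End HahnBanach.

(** * Stegall's variational principle *)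

Section Stegall.
Variables (R : realType) (k : scalars).
Local Notation K := (scalar_field R k).
Local Notation io := (@io R k).

Definition slice (V : Type) (D : set V) (f : V -> R) (al : R) : set V :=
  [set x | D x /\ forall y, D y -> f y <= f x + al].

Lemma slice_neq0 (V : Type) (D : set V) (f : V -> R) b al :
  D !=set0 -> (forall x, D x -> f x <= b) -> 0 < al -> slice D f al !=set0.
Proof.
move=> D0 fb al0; have [m [fm mm]] := sup_family D0 fb.
apply: contrapT => N; suff : m <= m - al by lra.
apply: mm => x Dx; rewrite leNgt; apply/negP => mx; apply: N; exists x; split=> // y /fm; lra.
Qed.

Lemma sub_hull (V : normedModType K) (A : set V) : A `<=` hull A.
Proof. by move=> x Ax C _ _; apply. Qed.

Lemma hull_closed (V : normedModType K) (A : set V) : eclosed (hull A).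
Proof.
move=> u uA C cC vC AC; apply: (cC) => e e0; have [a aA ua] := uA e e0.
by exists a => //; exact: aA.
Qed.

Lemma hull_convex (V : normedModType K) (A : set V) : econvex (hull A).
Proof. by move=> x y t xA yA t01 C cC vC AC; apply: (vC) => //; [exact: xA|exact: yA]. Qed.

Lemma RNP_dentable (V : normedModType K) (A : set V) M d :
  RNP V -> A !=set0 -> (forall x, A x -> nrm x <= M) -> 0 < d ->
  exists2 a, A a & ~ hull (A `\` [set b | nrm (b - a) < d]) a.
Proof.
move=> rnp A0 AM d0; have bA : bounded_set A.
  apply/bounded_setP; exists (Num.max M 1); first by rewrite lt_max ltr01 orbT.
  by move=> x /AM xM; rewrite le_max xM.
have d0' : 0 < io d by rewrite -io0 ltr_io.
have [a Aa aH] := rnp A A0 bA _ d0'; exists a => //; rewrite -hullE.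
suff <- : [set b | `|b - a| < io d] = [set b | nrm (b - a) < d] by [].
by apply/funext => b /=; rewrite -io_nrm ltr_io.
Qed.

(* If every slice of every [h + g] with [g] small were large, then the points
   nearly maximizing some [h + g], thickened by a radius which grows as the
   room left for perturbing [g] shrinks, would form a set which is not
   dentable: a functional cutting out a small piece around one such point
   would give a perturbation with a small slice. The parameter [th] measures
   the room left; passing from [th] to [th / 2] uses up half of it. *)
Lemma small_slice (V : normedModType K) (D : set V) (h : V -> R) M b e d :
  RNP V -> D !=set0 -> (forall x, D x -> nrm x <= M) -> (forall x, D x -> h x <= b) ->
  0 < e -> 0 < d ->
  exists g al p, [/\ rlinear g, forall x, g x <= e * nrm x, 0 < al &
    forall x, slice D (fun y => h y + g y) al x -> nrm (x - p) < d].
Proof.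
move=> rnp D0 DM hb e0 d0; pose c := d / 2; have c0 : 0 < c by rewrite /c; lra.
(* The width is quadratic in [th] because it must be beaten by [t * h'] below, a product of two
   quantities proportional to [th]. *)
pose al (th : R) := e * c * th ^+ 2 / 16.
have al0 th : 0 < th -> 0 < al th.
  by move=> th0; rewrite /al divr_gt0 // !mulr_gt0 // exprn_gt0.
pose L (th : R) (g : V -> R) p := [/\ 0 < th <= 1, rlinear g,
  forall x, g x <= e * (1 - th) * nrm x & slice D (fun y => h y + g y) (al th) p].
pose A : set V := [set a | exists th g p v, [/\ L th g p, nrm v <= c * (1 - th) & a = p + v]].
have gM (g : V -> R) s x : 0 <= s -> (forall x, g x <= s * nrm x) -> D x -> g x <= s * M.
  by move=> s0 gs Dx; apply: le_trans (gs x) _; rewrite ler_wpM2l // DM.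
have A0 : A !=set0.
  have [|p pS] := @slice_neq0 V D (fun y => h y + 0) b (al 1) D0 _ (al0 _ ltr01).
    by move=> x /hb; rewrite addr0.
  exists p, 1, (fun=> 0), p, 0; split; rewrite ?addr0 ?subrr ?mulr0 ?nrm0 //.
  split=> //; first by rewrite ltr01 lexx.
    exact: rlinear_zero.
  by move=> x; rewrite subrr mulr0 mul0r.
have AM a : A a -> nrm a <= M + c.
  move=> [th [g [p [v [[/andP[th0 th1] _ _ [/DM pM _]] vc ->]]]]].
  apply: le_trans (nrmD _ _) _; apply: lerD => //; apply: le_trans vc _.
  by rewrite ger_pMr //; lra.
have [a Aa aH] := RNP_dentable rnp A0 AM c0.
have [th [g [p [v [[/andP[th0 th1] rg ge pS] vc aE]]]]] := Aa.
have th2 : 0 < th / 2 <= 1 by lra.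
have th20 : 0 < th / 2 by lra.
have vc1 : c * (1 - th) <= c by rewrite ger_pMr //; lra.
have [G [C [rG GN C0 GC Ge]]] := separation (@hull_closed _ _) (@hull_convex _ _) aH.
(* If nothing of [A] lies outside the ball around [a], then a slice of [h + g] itself, being
   contained in [A], is already small. *)
have [H0|H0] := pselect (A `\` [set b | nrm (b - a) < c] !=set0); last first.
  exists g, (al (th / 2)), p; split=> // [x||x xS].
  - apply: le_trans (ge x) _; rewrite ler_wpM2r ?nrm_ge0 // ger_pMr //; lra.
  - exact: al0.
  have Ax : A x.
    exists (th / 2), g, x, 0; rewrite addr0 nrm0; split=> //; last by rewrite mulr_ge0 ?ltW //; lra.
    split=> // y; apply: le_trans (ge y) _; rewrite ler_wpM2r ?nrm_ge0 // ler_wpM2l ?ltW //; lra.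
  have : nrm (x - a) < c.
    by rewrite ltNge; apply/negP => xa; apply: H0; exists x; split=> //=; rewrite ltNge xa.
  have := nrm_triangle a x p; have -> : a - p = v by rewrite aE addrAC subrr add0r.
  move: vc; rewrite /c in vc1 *; lra.
(* Half of the room [th] is spent: [t] on the functional and [h'] on the thickening radius. *)
pose t := e * (th / 2); have t0 : 0 < t by rewrite mulr_gt0.
pose h' := c * (th / 2); have h'0 : 0 < h' by rewrite mulr_gt0.
have h'c : h' <= c / 2 by rewrite /h'; have := ler_wpM2l (ltW c0) th1; lra.
have [|f f1 fC] := Ge _ h' h'0.
  by have [y yA] := H0; exists y; exact: sub_hull.
pose g' x := g x + t * G x; have rg' : rlinear g' by exact: rlinearDZ.
have g'e x : g' x <= e * (1 - th / 2) * nrm x.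
  have := ler_wpM2l (ltW t0) (GN x); have := ge x; rewrite /g' /t; lra.
exists g', (al (th / 2)), p; split=> // [x||q qS].
- apply: le_trans (g'e x) _; rewrite ler_wpM2r ?nrm_ge0 // ger_pMr //; lra.
- exact: al0.
rewrite ltNge; apply/negP => qp.
(* A point [q] of the new slice far from [p] would give this point of [A] far from [a]. Moving by
   [h'] along [f], where [G] is almost norming, forces [G] to drop by at least [h'] from [p] to
   [q]. *)
pose y := q + (v + io h' *: f).
have h'f : nrm (io h' *: f) <= h'.
  by rewrite nrmZ nr_io gtr0_norm // ger_pMr.
have Ay : A y.
  exists (th / 2), g', q, (v + io h' *: f); split=> //; apply: le_trans (nrmD _ _) _.
  by move: h'f vc; rewrite /h'; lra.
have ya : c <= nrm (y - a).
  have -> : y - a = q - p + io h' *: f.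
    by rewrite /y aE [v + _]addrC addrA opprD addrACA subrr addr0 addrAC.
  have := nrm_triangle (- (io h' *: f)) (q - p) 0; rewrite subr0 opprK subr0 nrmN.
  rewrite /c in h'c *; lra.
have := GC y (@sub_hull _ _ _ (conj Ay _)); rewrite /= ltNge ya => /(_ (fun b => notF b)).
rewrite /y aE !rG.1 rG.2 => Gy.
(* Adding the two slice inequalities bounds [t * (G p - G q)] by the sum of the two widths, which is
   less than [t * h']. *)
have [Dp pmax] := pS; have [Dq qmax] := qS.
have := qmax p Dp; have := pmax q Dq; rewrite /g' => hq hp.
have : h' <= G p - G q by lra.
move=> /(ler_wpM2l (ltW t0)).
have : al th + al (th / 2) < t * h'.
  rewrite /al /t /h' -subr_gt0.
  have -> : e * (th / 2) * (c * (th / 2)) - (e * c * th ^+ 2 / 16 + e * c * (th / 2) ^+ 2 / 16) =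
    e * c * th ^+ 2 * (11 / 64) by field.
  by rewrite !mulr_gt0 // ?exprn_gt0 // divr_gt0.
by lra.
Qed.

Lemma le0_geom (C r : R) : (forall n, r <= C * 2^-1 ^+ n) -> r <= 0.
Proof.
move=> rC; rewrite leNgt; apply/negP => r0; have [n] := geom_small C r0.
by have := rC n; lra.
Qed.

Lemma real_complete_geom (u : nat -> R) (C : R) :
  (forall n m, (n <= m)%N -> `|u m - u n| <= C * 2^-1 ^+ n) ->
  exists l, forall n, `|u n - l| <= C * 2^-1 ^+ n.
Proof. exact: (@complete_geom R RealScalars R^o). Qed.

Lemma rlinear_abs (V : normedModType K) (g : V -> R) s :
  rlinear g -> (forall x, g x <= s * nrm x) -> forall x, `|g x| <= s * nrm x.
Proof.
move=> rg gs x; rewrite ler_norml gs andbT.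
by have := gs (- x); rewrite nrmN rlinearN //; lra.
Qed.

(** Iterating [small_slice] produces nested slices of vanishing size. Their points converge to [x0]
    and the functionals to [G]; since [h] is Lipschitz, almost maximality passes to the limit as
    maximality at [x0]. *)
Lemma perturbed_maximum (V : completeNormedModType K) (D : set V) (h : V -> R) M L e :
  RNP V -> D !=set0 -> (forall x, D x -> nrm x <= M) ->
  (forall x y, h x - h y <= L * nrm (x - y)) -> 0 < e ->
  exists g x0, [/\ rlinear g, forall x, g x <= e * nrm x, closure D x0 &
    forall y, D y -> h y + g y <= h x0 + g x0].
Proof.
move=> rnp [d0 Dd0] DM hL e0.
have M0 : 0 <= M by apply: le_trans (DM _ Dd0); exact: nrm_ge0.
(* A state consists of a functional, a slice width and a stage [n]. The bound [2^-1 ^+ n] on the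
   width makes the maxima exact in the limit. *)
pose inv (s : (V -> R) * R * nat) := [/\ rlinear s.1.1, 0 < s.1.2 <= 2^-1 ^+ s.2 &
  exists C, forall x, s.1.1 x <= C * nrm x].
pose St := {s | inv s}.
pose sl (s : St) := slice D (fun x => h x + (sval s).1.1 x) (sval s).1.2.
have hb (g : V -> R) C : (forall x, g x <= C * nrm x) ->
    forall x, D x -> h x + g x <= h d0 + L * nrm (x - d0) + C * nrm x.
  by move=> gC x Dx; have := gC x; have := hL x d0; lra.
have hb' (g : V -> R) C : (forall x, g x <= C * nrm x) ->
    exists b, forall x, D x -> h x + g x <= b.
  move=> gC; exists (h d0 + `|L| * (M + M) + `|C| * M) => x Dx.
  apply: le_trans (hb g C gC x Dx) _; apply: lerD; first apply: lerD => //.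
    apply: le_trans (ler_wpM2r (nrm_ge0 _) (ler_norm L)) _; rewrite ler_wpM2l //.
    by apply: le_trans (nrmD _ _) _; rewrite nrmN lerD // DM.
  apply: le_trans (ler_wpM2r (nrm_ge0 _) (ler_norm C)) _; rewrite ler_wpM2l //; exact: DM.
pose next (s t : St) := [/\ (sval t).2 = (sval s).2.+1,
  forall x, (sval t).1.1 x - (sval s).1.1 x <= e * 2^-1 ^+ (sval s).2.+1 * nrm x,
  sl t `<=` sl s & exists p, forall x, sl t x -> nrm (x - p) < 2^-1 ^+ (sval s).2].
have step s : {t | next s t}.
  apply: cid; case: s => -[[g al] n] gi; have [/= rg /andP[al0 aln] [C gC]] : inv (g, al, n) := gi.
  have [b fb] := hb' g C gC.
  have n0 m : 0 < 2^-1 ^+ m :> R by rewrite exprn_gt0 // invr_gt0.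
  (* The first bound makes the perturbations sum up to at most [e]. The second keeps their values on
     [D] within [al / 4], so that a new slice of width at most [al / 2] lies in the old one. *)
  pose e' := Num.min (e * 2^-1 ^+ n.+1) (al / (4 * (M + 1))).
  have e'0 : 0 < e' by rewrite lt_min mulr_gt0 // divr_gt0 // mulr_gt0 //; lra.
  have e'e : e' <= e * 2^-1 ^+ n.+1 by rewrite ge_min lexx.
  have e'M : e' * M <= al / 4.
    have : e' * (4 * (M + 1)) <= al by rewrite -ler_pdivlMr ?ge_min ?lexx ?orbT // mulr_gt0 //; lra.
    by have := ltW e'0; lra.
  have D0 : D !=set0 by exists d0.
  have [g1 [al1 [p [rg1 g1e al10 sp]]]] := small_slice rnp D0 DM fb e'0 (n0 n).
  pose g' x := g x + 1 * g1 x; have rg' : rlinear g' by exact: rlinearDZ.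
  pose al' := Num.min al1 (al / 2).
  have al'0 : 0 < al' by rewrite lt_min al10 /=; lra.
  have al'1 : al' <= al1 by rewrite ge_min lexx.
  have al'2 : al' <= al / 2 by rewrite ge_min lexx orbT.
  have it : inv (g', al', n.+1).
    split=> //=; first by rewrite al'0 exprS /=; lra.
    by exists (C + e') => x; rewrite /g' mulrDl mul1r lerD.
  exists (exist _ _ it); split=> //=.
  - move=> x; rewrite /g' mul1r addrC addKr; apply: le_trans (g1e x) _.
    by rewrite ler_wpM2r ?nrm_ge0.
  - move=> x [Dx xmax]; split=> // y Dy; have := xmax y Dy; rewrite /= /g' !mul1r.
    have g1M z : D z -> `|g1 z| <= al / 4.
      move=> Dz; apply: le_trans (rlinear_abs rg1 g1e z) (le_trans _ e'M).
      by rewrite ler_wpM2l ?DM // ltW.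
    have := g1M x Dx; have := g1M y Dy; rewrite !ler_norml => /andP[? ?] /andP[? ?]; lra.
  - exists p => x [Dx xmax]; apply: sp; split=> // y Dy.
    by have := xmax y Dy; rewrite /= /g' !mul1r; lra.
have i0 : inv (fun=> 0, 1, 0%N).
  split=> /=; [exact: rlinear_zero|by rewrite expr0 ltr01 lexx|].
  by exists 0 => x; rewrite mul0r.
have [f [f0 fS]] := dependent_choice step (exist _ _ i0).
have fn n : (sval (f n)).2 = n.
  by elim: n => [|n IH]; [rewrite f0|have [-> _ _ _] := fS n; rewrite IH].
pose g n := (sval (f n)).1.1; pose al n := (sval (f n)).1.2.
have rg n : rlinear (g n) by have [] := svalP (f n).
have al0 n : 0 < al n by have [_ /andP[]] := svalP (f n).
have aln n : al n <= 2^-1 ^+ n by have [_ /andP[_]] := svalP (f n); rewrite fn.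
have sub n m : (n <= m)%N -> sl (f m) `<=` sl (f n).
  move=> /subnK <-; elim: (m - n)%N => [//|j IH]; rewrite addSn.
  by have [_ _ S _] := fS (j + n)%N; exact: subset_trans IH.
have /choice [x xS] n : exists x, sl (f n) x.
  have [_ _ [C gC]] := svalP (f n); have [b fb] := hb' _ C gC.
  by apply: (slice_neq0 _ fb (al0 n)); exists d0.
have half n : 2^-1 ^+ n = 2^-1 ^+ n.+1 + 2^-1 ^+ n.+1 :> R by rewrite exprS; lra.
(* It is slice [n.+1] that lies in a ball of radius [2^-1 ^+ n], hence the shifted index; the factor
   2 passes from radius to diameter. *)
have [x0 x0P] : exists x0, forall n, nrm (x n.+1 - x0) <= 2 * 2^-1 ^+ n.
  apply: (@complete_geom _ _ _ (fun n => x n.+1)) => n m nm.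
  have [_ _ _ [p]] := fS n; rewrite fn => pP.
  apply: le_trans (nrm_triangle p _ _) _; rewrite [nrm (p - _)]nrm_distC.
  have := pP _ (xS n.+1); have := pP _ (@sub n.+1 m.+1 nm _ (xS m.+1)); lra.
have gdiff n m z : (n <= m)%N -> `|g m z - g n z| <= e * nrm z * 2^-1 ^+ n.
  have rd : rlinear (fun z => g m z - g n z).
    by split=> [y w|t y]; rewrite ?((rg m).1, (rg n).1, (rg m).2, (rg n).2); ring.
  move=> nm; rewrite mulrAC; apply: (rlinear_abs rd) => {}z.
  suff : g m z - g n z <= e * (2^-1 ^+ n - 2^-1 ^+ m) * nrm z.
    have : 0 <= e * 2^-1 ^+ m * nrm z.
      by rewrite !mulr_ge0 ?nrm_ge0 ?exprn_ge0 ?invr_ge0 // ltW.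
    by lra.
  move: nm => /subnK <-; elim: (m - n)%N => [|j IH].
    by rewrite add0n !subrr mulr0 mul0r.
  have [_ + _ _] := fS (j + n)%N; rewrite fn => /(_ z); rewrite -/(g _ z) -/(g _ z) addSn.
  by move: IH; rewrite (half (j + n)%N); lra.
have /choice [G GP] z : exists l, forall n, `|g n z - l| <= e * nrm z * 2^-1 ^+ n.
  by apply: real_complete_geom => n m; exact: gdiff.
have GP' z n : g n z - G z <= e * nrm z * 2^-1 ^+ n /\ G z - g n z <= e * nrm z * 2^-1 ^+ n.
  by have := GP z n; rewrite ler_norml => /andP[? ?]; split; lra.
have rG : rlinear G.
  split=> [z w|t z]; apply/eqP; rewrite -subr_eq0 -normr_le0.
    apply: (@le0_geom (e * nrm (z + w) + e * nrm z + e * nrm w)) => n.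
    have [] := (GP' (z + w) n, GP' z n) => -[? ?] [? ?]; have [? ?] := GP' w n.
    by have := (rg n).1 z w; rewrite ler_norml => ?; apply/andP; split; lra.
  apply: (@le0_geom (e * nrm (io t *: z) + `|t| * (e * nrm z))) => n.
  have := GP (io t *: z) n; have := ler_wpM2l (normr_ge0 t) (GP z n).
  rewrite -normrM (rg n).2 => h1 h2.
  have -> : G (io t *: z) - t * G z = t * (g n z - G z) - (t * g n z - G (io t *: z)) by ring.
  by apply: le_trans (ler_normB _ _) _; lra.
have Ge z : G z <= e * nrm z.
  have [_] := GP' z 0%N; rewrite expr0 mulr1 /g f0 /=; lra.
exists G, x0; split=> //.
  apply/closureP => r r0; have [n nr] := geom_small 2 r0.
  by exists (x n.+1); [case: (xS n.+1)|rewrite nrm_distC; apply: le_lt_trans (x0P n) nr].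
(* The constant collects the errors: replacing [G] by [g n.+1] at [y] and at [x n.+1], the slice
   width, and moving from [x n.+1] to [x0] in [h] and in [G]. *)
move=> y Dy; rewrite -subr_le0; apply: (@le0_geom (e * M + e * M + 1 + `|L| * 2 + e * 2)) => n.
have [Dx xmax] := xS n.+1; have := xmax y Dy; rewrite -/(g _ _) -/(g _ _) -/(al _) => xy.
have e2n : 0 <= e * 2^-1 ^+ n by rewrite mulr_ge0 ?exprn_ge0 ?invr_ge0 // ltW.
have eM z : D z -> e * nrm z * 2^-1 ^+ n.+1 <= e * M * 2^-1 ^+ n.
  move=> Dz; rewrite mulrAC [e * M * _]mulrAC; apply: ler_pM; rewrite ?nrm_ge0 ?DM //.
    by rewrite mulr_ge0 ?exprn_ge0 ?invr_ge0 // ltW.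
  by rewrite ler_pM2l // (half n) lerDl exprn_ge0 // invr_ge0.
have [_ yG] := GP' y n.+1; have [xG _] := GP' (x n.+1) n.+1.
have := eM _ Dy; have := eM _ Dx; have := aln n.+1.
have LL : h (x n.+1) - h x0 <= `|L| * (2 * 2^-1 ^+ n).
  apply: le_trans (hL _ _) _; apply: le_trans (ler_wpM2r (nrm_ge0 _) (ler_norm L)) _.
  by rewrite ler_wpM2l.
have GG : G (x n.+1) - G x0 <= e * (2 * 2^-1 ^+ n).
  rewrite -rlinearB //; apply: le_trans (Ge _) _; rewrite ler_wpM2l //; exact: ltW.
have := half n; have : 0 < 2^-1 ^+ n.+1 :> R by rewrite exprn_gt0 // invr_gt0.
by lra.
Qed.

End Stegall.

(** * Approximation by quasi norm attaining operators *)

Section Approximation.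
Variables (R : realType) (k : scalars).
Local Notation K := (scalar_field R k).
Local Notation io := (@io R k).

Lemma scalar_extension (V : lmodType K) (g : V -> R) : rlinear g ->
  exists f : V -> K, (forall a x y, f (a *: x + y) = a * f x + f y) /\ forall x, re (f x) = g x.
Proof.
move: V g; rewrite /rlinear /Defs.scalar_field; case: k => V g [gD gZ] /=.
  by exists g; split=> // a x y; rewrite gD gZ.
have [i iE] : exists i : R[i], i = Complex 0 1 by exists (Complex 0 1).
(* The usual complexification [g x - i * g (i x)]. *)
exists (fun x => Complex (g x) (- g (i *: x))); split=> // -[a b] x y.
have aE (c d : R) z : g (Complex c d *: z) = c * g z + d * g (i *: z).
  rewrite -!gZ -gD scalerA -scalerDl; congr (g (_ *: _)).
  by rewrite iE; apply/eqP; rewrite eq_complex /=; apply/andP; split; apply/eqP; ring.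
have iM : i * Complex a b = Complex (- b) a.
  by rewrite iE; apply/eqP; rewrite eq_complex /=; apply/andP; split; apply/eqP; ring.
rewrite scalerDr scalerA iM !gD !aE.
by apply/eqP; rewrite eq_complex /=; apply/andP; split; apply/eqP; ring.
Qed.

Lemma scalar_extension_bound (V : normedModType K) (g : V -> R) (f : V -> K) s :
  (forall a x y, f (a *: x + y) = a * f x + f y) -> (forall x, re (f x) = g x) ->
  (forall x, g x <= s * nrm x) -> forall x, nr (f x) <= s * nrm x.
Proof.
move=> fL fg gs x; have [c c1 cf] := rotation (f x).
have f0 : f 0 = 0 by have := fL 1 0 0; rewrite scaler0 addr0 mul1r -{1}[f 0]addr0 => /addrI.
have fZ : f (c *: x) = io (nr (f x)) by rewrite -[c *: x]addr0 fL f0 addr0.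
by rewrite -[nr _](@ioK R k) -fZ fg; apply: le_trans (gs _) _; rewrite nrmZ c1 mul1r.
Qed.

Lemma linear_pack (U V : lmodType K) (f : U -> V) : linear f ->
  exists F : {linear U -> V}, forall x, F x = f x.
Proof.
move=> lf; pose F : {linear U -> V} := HB.pack f (GRing.isLinear.Build K U V *:%R f lf).
by exists F.
Qed.

Lemma opnorm_le (X Y : normedModType K) (f : X -> Y) b :
  (forall x, nrm x <= 1 -> nrm (f x) <= b) -> opnorm f <= io b.
Proof. by move=> fb; have [m [-> _ ml]] := opnormP fb; rewrite ler_io; exact: ml. Qed.

Lemma opnorm_closure (X Y : normedModType K) (f : X -> Y) u :
  closure (f @` unit_ball X) u -> (forall x, nrm x <= 1 -> nrm (f x) <= nrm u) ->
  `|u| = opnorm f.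
Proof.
move=> /closureP cu fu; have [m [-> fm ml]] := opnormP fu; rewrite -io_nrm; congr io.
apply/eqP; rewrite eq_le ml // andbT; apply/ler_addgt0Pr => e e0.
have [_ [x x1 <-] ux] := cu e e0.
have {}x1 : nrm x <= 1 by move: x1; rewrite /unit_ball /= -io_nrm -io1 ler_io.
have := fm x x1; have := nrmD (u - f x) (f x); rewrite subrK; lra.
Qed.

(** Factoring through [Z] treats domain and codomain at once: [T1] or [T2] will be the identity
    between [Z] and a renorming. *)
Lemma QNA_approximation (X Y : normedModType K) (Z : completeNormedModType K)
    (T1 : {linear X -> Z}) (T2 : {linear Z -> Y}) (T : {linear X -> Y}) e :
  RNP Z -> bounded_operators T1 -> bounded_operators T2 ->
  (forall x, T x = T2 (T1 x)) -> 0 < e ->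
  exists2 S, QNA X Y S & opnorm (T \- S) < io e.
Proof.
move=> rnp /bounded_operatorsP[M1 M10 T1M] /bounded_operatorsP[M2 M20 T2M] TE e0.
(* The zero operator attains its norm at 0. Otherwise [T x1] guarantees that [Y] has unit
   vectors. *)
have [T0|/existsNP[x1 /eqP Tx1]] := pselect (forall x, T x = 0).
  exists T; last first.
    apply: le_lt_trans (@opnorm_le _ _ _ 0 _) _; last by rewrite ltr_io.
    by move=> x _ /=; rewrite subrr nrm0.
  split; first by apply/bounded_operatorsP; exists 0 => // x; rewrite T0 nrm0 mul0r.
  exists 0; last apply: opnorm_closure.
  - by apply: subset_closure; exists 0; rewrite ?T0 // /unit_ball /= normr0.
  - by apply: subset_closure; exists 0; rewrite ?T0 // /unit_ball /= normr0.
  - by move=> x _; rewrite T0.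
pose D : set Z := T1 @` unit_ball X.
have ballE (x : X) : unit_ball X x <-> nrm x <= 1.
  by rewrite /unit_ball /= -io_nrm -io1 ler_io.
have D0 : D !=set0 by exists (T1 0), 0 => //; apply/ballE; rewrite nrm0.
have DM z : D z -> nrm z <= M1.
  by move=> [y /ballE y1 <-]; apply: le_trans (T1M _) _; rewrite ler_piMr.
have hL x y : nrm (T2 x) - nrm (T2 y) <= M2 * nrm (x - y).
  apply: le_trans (T2M _); rewrite linearB lerBlDr.
  by have := nrmD (T2 x - T2 y) (T2 y); rewrite subrK.
pose d := e / (2 * (M1 + 1)); have d0 : 0 < d by rewrite divr_gt0 // mulr_gt0 //; lra.
have dM : d * M1 <= e / 2.
  have : d * (2 * (M1 + 1)) = e by rewrite divfK // mulf_neq0 // lt0r_neq0 //; lra.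
  by lra.
have [g [z0 [rg gd z0D gmax]]] := perturbed_maximum rnp D0 DM hL d0.
have [f [fL fg]] := scalar_extension rg.
have fd := scalar_extension_bound fL fg gd.
(* [u] is [T2 z0] normalized and rotated so that [f z0 *: u] is a nonnegative multiple of [T2 z0];
   the norms then add up. If [T2 z0 = 0], any unit vector will do. *)
have [u u1 uE] : exists2 u, nrm u <= 1 & nrm (T2 z0 + f z0 *: u) = nrm (T2 z0) + nr (f z0).
  have [T20|T20] := eqVneq (T2 z0) 0.
    have n0 : nrm (T x1) != 0 by apply: contra_neq Tx1; exact: nrm0_eq0.
    have n1 : nrm (io (nrm (T x1))^-1 *: T x1) = 1.
      by rewrite nrmZ nr_io ger0_norm ?invr_ge0 ?nrm_ge0 // mulVf.
    by exists (io (nrm (T x1))^-1 *: T x1); rewrite ?n1 // T20 add0r nrmZ n1 mulr1 nrm0 add0r.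
  have n0 : nrm (T2 z0) != 0 by apply: contra_neq T20; exact: nrm0_eq0.
  have [c c1 cf] := rotation (f z0).
  exists ((c * io (nrm (T2 z0))^-1) *: T2 z0).
    by rewrite nrmZ nrM c1 mul1r nr_io ger0_norm ?invr_ge0 ?nrm_ge0 // mulVf.
  rewrite scalerA mulrA [f z0 * c]mulrC cf -ioM -{1}[T2 z0]scale1r -io1 -scalerDl -ioD nrmZ nr_io.
  rewrite ger0_norm ?addr_ge0 ?divr_ge0 ?nrm_ge0 ?nr_ge0 //.
  by rewrite mulrDl mul1r divfK.
have [S SE] : exists S : {linear X -> Y}, forall x, S x = T x + f (T1 x) *: u.
  apply: linear_pack => a x y /=; rewrite !linearP fL scalerDl scalerDr scalerA.
  by rewrite addrACA.
have nfu z : nrm (f z *: u) <= nr (f z) by rewrite nrmZ ler_piMr // nr_ge0.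
have T1ball x : nrm x <= 1 -> nrm (T1 x) <= M1.
  by move=> x1'; apply: DM; exists x => //; apply/ballE.
exists S; last first.
  apply: le_lt_trans (@opnorm_le _ _ _ (e / 2) _) _; last by rewrite ltr_io; lra.
  move=> x x1' /=; rewrite SE opprD addrA subrr sub0r nrmN; apply: le_trans (nfu _) _.
  apply: le_trans (fd _) (le_trans _ dM); rewrite ler_pM2l //; exact: T1ball.
split.
  pose B : R := M2 * M1 + d * M1; apply/bounded_operatorsP; exists B; rewrite /B.
    exact: addr_ge0 (mulr_ge0 M20 M10) (mulr_ge0 (ltW d0) M10).
  move=> x; rewrite SE TE mulrDl; apply: le_trans (nrmD _ _) _; apply: lerD.
    by apply: le_trans (T2M _) _; rewrite -mulrA ler_wpM2l.
  apply: le_trans (nfu _) _; apply: le_trans (fd _) _; rewrite -mulrA ler_wpM2l //; exact: ltW.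
have uC : closure (S @` unit_ball X) (T2 z0 + f z0 *: u).
  apply/closureP => r r0; move/closureP: z0D.
  have C0 : 0 < M2 + d by lra.
  move=> /(_ (r / (M2 + d)) (divr_gt0 r0 C0)) [_ [x x1' <-] xz].
  exists (S x); first by exists x.
  have fB : f z0 - f (T1 x) = f (z0 - T1 x).
    by rewrite addrC -mulN1r -fL scaleN1r addrC.
  rewrite SE TE opprD addrACA -linearB -scalerBl fB; apply: le_lt_trans (nrmD _ _) _.
  rewrite ltr_pdivlMr // in xz; apply: le_lt_trans xz; rewrite mulrC mulrDl lerD //.
  by apply: le_trans (nfu _) _.
exists (T2 z0 + f z0 *: u) => //; apply: opnorm_closure => // x x1'.
rewrite SE TE uE; apply: le_trans (nrmD _ _) _.
apply: le_trans (lerD (lexx _) (nfu _)) _.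
(* [z0] maximizes only with the real part of [f]. Since [D] is stable under rotations, [x] may be
   rotated until [f (T1 x)] equals its modulus. *)
have [c c1 cf] := rotation (f (T1 x)).
have f0 : f 0 = 0 by have := fL 1 0 0; rewrite scaler0 addr0 mul1r -{1}[f 0]addr0 => /addrI.
have fZ : f (c *: T1 x) = io (nr (f (T1 x))) by rewrite -[c *: _]addr0 fL f0 addr0.
have : D (c *: T1 x).
  by exists (c *: x); rewrite ?linearZ //; apply/ballE; rewrite nrmZ c1 mul1r.
move=> /gmax; rewrite -!fg fZ ioK linearZ /= nrmZ c1 mul1r => h; apply: le_trans h _.
by rewrite lerD2l re_le_nr.
Qed.

End Approximation.

(** * Sets all of whose slices are large *)

Section NonDentable.
Variables (R : realType) (k : scalars).
Local Notation K := (scalar_field R k).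
Local Notation io := (@io R k).
Variable V : normedModType K.
Implicit Types (A C S W : set V) (g p : V -> R).

Lemma hullS A S : A `<=` S -> hull A `<=` hull S.
Proof. by move=> AS z zA C cC vC SC; apply: zA => //; exact: subset_trans SC. Qed.

Lemma sequence_merge (T : Type) (s : nat -> nat -> T) :
  exists t : nat -> T, (forall n, exists i j, t n = s i j) /\ forall i j, exists n, t n = s i j.
Proof.
pose c (n : nat) := odflt (0, 0)%N (unpickle n : option (nat * nat)).
exists (fun n => s (c n).1 (c n).2); split=> [n|i j]; first by exists (c n).1, (c n).2.
by exists (pickle (i, j)); rewrite /c pickleK.
Qed.

(** The points lying in the hull of some countable subset of [S] form a closed convex set, as
    countably many sequences merge into one. *)
Lemma hull_countable S z : hull S z ->
  exists s : nat -> V, (forall n, S (s n)) /\ hull (range s) z.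
Proof.
move=> zS; pose G := [set y | exists s : nat -> V, (forall n, S (s n)) /\ hull (range s) y].
apply: (zS G) => [u uS|x y t [s1 [s1S xs]] [s2 [s2S ys]] t01|x Sx].
- have /choice [a aP] n : exists a, (exists s : nat -> V, (forall n, S (s n)) /\ hull (range s) a) /\
      nrm (u - a) < 2^-1 ^+ n.
    by have [|a aS ua] := uS (2^-1 ^+ n); [rewrite exprn_gt0 // invr_gt0|exists a].
  have /choice [s sP] n := (aP n).1.
  have [t [ts st]] := sequence_merge s; exists t; split=> [n|].
    by have [i [j ->]] := ts n; exact: (sP i).1.
  apply: hull_closed => e e0; have [n ne] := geom_small 1 e0.
  exists (a n); last by apply: lt_trans (aP n).2 _; rewrite mul1r in ne.
  by apply: hullS (sP n).2 => _ [j _ <-]; have [m <-] := st n j; exists m.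
- have [r [rs sr]] := sequence_merge (fun i => if i == 0%N then s1 else s2).
  exists r; split=> [n|]; first by have [[|i] [j ->]] := rs n.
  apply: hull_convex => //.
    by apply: hullS xs => _ [j _ <-]; have [m mE] := sr 0%N j; exists m.
  by apply: hullS ys => _ [j _ <-]; have [m mE] := sr 1%N j; exists m.
- by exists (fun=> x); split=> //; apply: sub_hull; exists 0%N.
Qed.

(** Each point of [A] is in the hull of a sequence of points of [A] far from it. Starting from [a0]
    and replacing points by such sequences gives a tree indexed by finite words of integers, hence
    countable. *)
Lemma countable_nondentable A d : A !=set0 ->
  (forall a, A a -> hull (A `\` [set b | nrm (b - a) < d]) a) ->
  exists x : nat -> V, (forall i, A (x i)) /\
    forall i, hull [set b | range x b /\ d <= nrm (b - x i)] (x i).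
Proof.
move=> [a0 Aa0] Ahull.
have /choice [F FP] a : exists s : nat -> V, A a ->
    (forall n, A (s n) /\ d <= nrm (s n - a)) /\ hull (range s) a.
  have [Aa|nAa] := pselect (A a); last by exists (fun=> a0).
  have [s [sA sa]] := hull_countable (Ahull a Aa); exists s => _; split=> // n.
  by have [? /negP] := sA n; rewrite -leNgt.
pose X (w : seq nat) := foldl F a0 w.
have XA w : A (X w).
  by elim/last_ind: w => // w n IH; rewrite /X foldl_rcons; have [/(_ n) []] := FP _ IH.
exists (fun n => X (odflt [::] (unpickle n))); split=> // i.
set w := odflt _ _; have [Fd] := FP _ (XA w); apply: hullS => _ [n _ <-]; split; last exact: (Fd n).2.
by exists (pickle (rcons w n)); rewrite // pickleK /= /X foldl_rcons.
Qed.

Definition lipschitz g L := forall x y, g x - g y <= L * nrm (x - y).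

Definition convex_fun g := forall x y t, 0 <= t <= 1 ->
  g (io t *: x + io (1 - t) *: y) <= t * g x + (1 - t) * g y.

Lemma sublevel_closed g L al : lipschitz g L -> eclosed [set x | g x <= al].
Proof.
move=> gL u uP /=; apply/ler_addgt0Pr => e e0.
have L0 : 0 < `|L| + 1 by have := normr_ge0 L; lra.
have [a /= ga ua] := uP _ (divr_gt0 e0 L0); have := gL u a.
rewrite ltr_pdivlMr // in ua; have := ler_wpM2r (nrm_ge0 (u - a)) (ler_norm L).
have := nrm_ge0 (u - a); lra.
Qed.

Lemma sublevel_convex g al : convex_fun g -> econvex [set x | g x <= al].
Proof.
move=> gC x y t /= gx gy t01; apply: le_trans (gC x y t t01) _.
move: t01 => /andP[t0 t1]; have t1' : 0 <= 1 - t by lra.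
by have := ler_wpM2l t0 gx; have := ler_wpM2l t1' gy; lra.
Qed.

Lemma rlinear_convex g : rlinear g -> convex_fun g.
Proof. by move=> [gD gZ] x y t _; rewrite gD !gZ. Qed.

Lemma rlinear_lipschitz g s : rlinear g -> (forall x, g x <= s * nrm x) -> lipschitz g s.
Proof. by move=> rg gs x y; rewrite -rlinearB. Qed.

Definition balanced C := forall a x, nr a <= 1 -> C x -> C (a *: x).

(** No slice fits in an open ball of radius [d], wherever its centre lies; balls to be removed later
    need not be centred in [C]. *)
Definition big_slices C d := forall g s al z, rlinear g -> (forall x, g x <= s * nrm x) ->
  C z -> al < g z -> forall y, exists q, [/\ C q, al < g q & d <= nrm (q - y)].

(* [V'] lies in a small ball; a functional separating a point of [C] from
   [hull W] is almost maximal only on points of [C] close to [V']. *)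
Lemma hull_remove_ball C W V' M d y0 r : big_slices C d ->
  (forall x, C x -> nrm x <= M) -> W `<=` C -> V' `<=` C ->
  (forall x, V' x -> nrm (x - y0) <= r) -> 0 <= r < d ->
  C `<=` hull (W `|` V') -> C `<=` hull W.
Proof.
move=> Cd CM WC VC Vr /andP[r0 rd] CWV x Cx; apply: contrapT => Wx.
have [G [D [rG GN D0 GD _]]] := separation (@hull_closed _ _ _ W) (@hull_convex _ _ _ W) Wx.
have [|s [Gs smin]] := @sup_family _ _ C G M (ex_intro _ x Cx).
  by move=> y Cy; exact: le_trans (GN y) (CM y Cy).
pose Q := M + nrm y0 + 1.
have M0 : 0 <= M := le_trans (nrm_ge0 x) (CM x Cx).
have Q0 : 0 < Q by rewrite /Q; have := nrm_ge0 y0; lra.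
have QD0 : 0 < Q / D by exact: divr_gt0.
have QDD : Q / D * D = Q by rewrite divfK // gt_eqF.
(* The left side is a continuous convex function, so it suffices to bound it on [V'], by the radius,
   and on [W], where [G] is lower by [D] and this pays for the distance bound [Q]. *)
have key z : C z -> nrm (z - y0) + Q / D * G z <= r + Q / D * s.
  move=> Cz; apply: (CWV z Cz [set z | nrm (z - y0) + Q / D * G z <= r + Q / D * s]).
  - apply: (@sublevel_closed (fun z => nrm (z - y0) + Q / D * G z) (1 + Q / D)) => a b.
    have := ler_wpM2l (ltW QD0) (GN (a - b)); rewrite rlinearB //.
    have := nrmD (a - b) (b - y0); rewrite addrA subrK; lra.
  - apply: sublevel_convex => a b t /andP[t0 t1]; rewrite rG.1 !rG.2.
    have -> : io t *: a + io (1 - t) *: b - y0 = io t *: (a - y0) + io (1 - t) *: (b - y0).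
      by rewrite !scalerBr addrACA -opprD -scalerDl -ioD [t + _]addrC subrK io1 scale1r.
    have := nrmD (io t *: (a - y0)) (io (1 - t) *: (b - y0)).
    rewrite !nrmZ !nr_io !ger0_norm ?subr_ge0 //; lra.
  - move=> w [Ww|/[dup] Vw /Vr]; last first.
      by have := ler_wpM2l (ltW QD0) (Gs _ (VC _ Vw)); rewrite /=; lra.
    have wQ : nrm (w - y0) <= Q.
      by have := nrmD w (- y0); have := CM _ (WC _ Ww); rewrite nrmN /Q; lra.
    have wD : G w + D <= s by apply: le_trans (Gs _ Cx); apply: GD; exact: sub_hull.
    have := ler_wpM2l (ltW QD0) wD; rewrite mulrDr QDD /=; lra.
(* Chosen so that [Q / D * b = (d - r) / 2]: by [key], the slice of width [b] stays at distance less
   than [d] from [y0]. *)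
pose b := (d - r) * D / (2 * Q).
have b0 : 0 < b by rewrite /b divr_gt0 // mulr_gt0 // subr_gt0.
have [z Cz zb] : exists2 z, C z & s - b < G z.
  apply: contrapT => N; suff : s <= s - b by lra.
  by apply: smin => z Cz; rewrite leNgt; apply/negP => zb; apply: N; exists z.
have GN' y : G y <= 1 * nrm y by rewrite mul1r.
have [q [Cq qb qd]] := Cd _ _ _ _ rG GN' Cz zb y0.
have := key q Cq; have : Q / D * (s - G q) < Q / D * b by rewrite ltr_pM2l //; lra.
have -> : Q / D * b = (d - r) / 2 by rewrite /b; field; rewrite !gt_eqF.
lra.
Qed.

(** Meant for [P] saying that an admissible seminorm is large: its complement is then covered by
    finitely many balls, removed one at a time. *)
Lemma hull_remove_balls C (P : set V) M d r (l : seq V) : big_slices C d ->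
  (forall x, C x -> nrm x <= M) -> 0 <= r < d ->
  (forall x, C x -> ~ P x -> exists2 y, y \in l & nrm (x - y) <= r) ->
  C `<=` hull (C `&` P).
Proof.
move=> Cd CM rd; pose B (l : seq V) := [set x : V | exists2 y, y \in l & nrm (x - y) <= r].
move=> CP; have : C `<=` hull ((C `&` P) `|` (C `&` B l)).
  move=> x Cx; apply: sub_hull; have [Px|/(CP x Cx)] := pselect (P x); first by left.
  by right.
elim: l {CP} => [|y l IH] CB.
  move=> x /CB; apply: hullS => z [//|[_ []]].
  by move=> y; rewrite in_nil.
apply: IH; apply: (@hull_remove_ball C _ (C `&` [set x | nrm (x - y) <= r]) M d y r) => //.
- by move=> x [[]|[]].
- by move=> x [].
move=> x /CB; apply: hullS => z [?|[Cz [y']]]; first by left; left.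
rewrite inE => /predU1P[-> zy|y'l zy]; first by right.
by left; right; split=> //; exists y'.
Qed.

Definition abs_hull A : set V := fun z =>
  forall C, eclosed C -> econvex C -> balanced C -> A `<=` C -> C z.

Lemma sub_abs_hull A : A `<=` abs_hull A.
Proof. by move=> x Ax C _ _ _; apply. Qed.

Lemma abs_hull_convex A : econvex (abs_hull A).
Proof.
by move=> x y t xA yA t01 C cC vC bC AC; apply: (vC) => //; [exact: xA|exact: yA].
Qed.

Lemma abs_hull_balanced A : balanced (abs_hull A).
Proof. by move=> a x a1 xA C cC vC bC AC; apply: (bC) => //; exact: xA. Qed.

Lemma abs_hull_bounded A M : (forall x, A x -> nrm x <= M) -> forall x, abs_hull A x -> nrm x <= M.
Proof.
move=> AM x Ax; apply: (Ax [set x | nrm x <= M]) => //.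
- by apply: (@sublevel_closed (@nrm _ _ V) 1) => a b; have := nrmD (a - b) b; rewrite subrK mul1r; lra.
- apply: (@sublevel_convex (@nrm _ _ V)) => a b t /andP[t0 t1].
  apply: le_trans (nrmD _ _) _; rewrite !nrmZ !nr_io !ger0_norm ?subr_ge0 //; lra.
- move=> a y a1 /= yM; rewrite nrmZ; apply: le_trans yM; exact: ler_piMl (nrm_ge0 _) a1.
Qed.

(** A slice of the hull contains two points [u *: x i] and [u *: x j] at distance at least [d]; one
    of them is at least [d / 2] away from any given [y]. *)
Lemma abs_hull_big_slices (x : nat -> V) d :
  (forall i, hull [set b | range x b /\ d <= nrm (b - x i)] (x i)) ->
  big_slices (abs_hull (range x)) (d / 2).
Proof.
move=> xd g s al z rg gs Cz gz y.
have rgu u : rlinear (fun v => g (u *: v)).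
  split=> [v w|t v]; first by rewrite scalerDr rg.1.
  by rewrite scalerA mulrC -scalerA rg.2.
have gus u v : nr u = 1 -> g (u *: v) <= s * nrm v.
  by move=> u1; apply: le_trans (gs _) _; rewrite nrmZ u1 mul1r.
(* Otherwise the points all of whose rotations have [g] at most [al] form a closed convex balanced
   set containing the sequence, hence [z]. Balancedness uses [0 <= al]. *)
have [i [u [u1 gu]]] : exists i u, nr u = 1 /\ al < g (u *: x i).
  apply: contrapT => N.
  have N' i u : nr u = 1 -> g (u *: x i) <= al.
    by move=> u1; rewrite leNgt; apply/negP => gu; apply: N; exists i, u.
  have al0 : 0 <= al.
    have := N' 0%N 1 (nr1 _ _); have := N' 0%N (- 1).
    by rewrite /nr normrN scaleN1r rlinearN // scale1r => /(_ (nr1 _ _)); lra.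
  suff : g (1 *: z) <= al by rewrite scale1r; lra.
  apply: (Cz [set v | forall u, nr u = 1 -> g (u *: v) <= al]); rewrite ?nr1 //.
  - move=> v vP u u1.
    have := @sublevel_closed _ s al (rlinear_lipschitz (rgu u) (fun w => gus u w u1)) v.
    apply=> e e0; have [a aP va] := vP e e0; exists a => //; exact: aP.
  - move=> v w t vP wP t01 u u1.
    by apply: (sublevel_convex (rlinear_convex (rgu u))) => //=; [exact: vP|exact: wP].
  - move=> a v a1 vP u u1; rewrite scalerA.
    have [->|a0] := eqVneq a 0; first by rewrite mulr0 scale0r rlinear0.
    have na0 : nr a != 0 by apply: contra_neq a0; exact: nr0_eq0.
    have -> : u * a = io (nr a) * (u * a / io (nr a)).
      rewrite [RHS]mulrC divfK //; apply: contra_neq na0 => h.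
      by apply: (can_inj (@ioK R k)); rewrite h io0.
    rewrite -scalerA rg.2.
    have /vP : nr (u * a / io (nr a)) = 1.
      by rewrite !nrM nrV nr_io u1 mul1r ger0_norm ?nr_ge0 // divff.
    move=> /(ler_wpM2l (nr_ge0 a)); have := ler_wpM2r al0 a1; lra.
  - by move=> _ [i _ <-] u; exact: N'.
have [b [[j _ <-] dj] gb] : exists2 b, range x b /\ d <= nrm (b - x i) & al < g (u *: b).
  apply: contrapT => N; suff : g (u *: x i) <= al by lra.
  apply: (xd i [set v | g (u *: v) <= al]).
  - exact: (@sublevel_closed (fun v => g (u *: v)) s al
      (rlinear_lipschitz (rgu u) (fun w => gus u w u1))).
  - exact: (@sublevel_convex (fun v => g (u *: v)) al (rlinear_convex (rgu u))).
  - by move=> b bP; rewrite /= leNgt; apply/negP => gb; apply: N; exists b.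
have Cu l : abs_hull (range x) (u *: x l).
  by apply: abs_hull_balanced; [rewrite u1|apply: sub_abs_hull; exists l].
have [iy|iy] := leP (d / 2) (nrm (u *: x i - y)); first by exists (u *: x i).
exists (u *: x j); split=> //.
have := nrm_triangle y (u *: x j) (u *: x i); rewrite -scalerBr nrmZ u1 mul1r.
by rewrite [nrm (y - _)]nrm_distC; lra.
Qed.

End NonDentable.

(** * Seminorms shortening finitely many vectors, their series, and gauges *)

Section Seminorms.
Variables (R : realType) (k : scalars).
Local Notation K := (scalar_field R k).
Local Notation io := (@io R k).
Variable V : normedModType K.
Implicit Types (p q : V -> R).

Definition seminorm p :=
  (forall x y, p (x + y) <= p x + p y) /\ (forall a x, p (a *: x) = nr a * p x).

Lemma seminorm_of_le p : (forall x y, p (x + y) <= p x + p y) ->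
  (forall a x, p (a *: x) <= nr a * p x) -> seminorm p.
Proof.
move=> pD pZ; split=> // a x; apply/eqP; rewrite eq_le pZ /=.
have [->|a0] := eqVneq a 0.
  by have := pD 0 0; rewrite addr0 scale0r nr0 mul0r; lra.
have na0 : 0 < nr a.
  by rewrite lt_def nr_ge0 andbT; apply: contra_neq a0; exact: nr0_eq0.
by have := pZ a^-1 (a *: x); rewrite scalerA mulVf // scale1r nrV ler_pdivlMl.
Qed.

Lemma seminorm_nrm : seminorm (@nrm _ _ V).
Proof. by split=> *; [exact: nrmD|exact: nrmZ]. Qed.

Lemma seminorm0 p : seminorm p -> p 0 = 0.
Proof. by move=> [_ pZ]; rewrite -(scale0r 0) pZ nr0 mul0r. Qed.

Lemma seminormN p x : seminorm p -> p (- x) = p x.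
Proof. by move=> [_ pZ]; rewrite -scaleN1r pZ /nr normrN -/(nr 1) nr1 mul1r. Qed.

Lemma seminorm_ge0 p x : seminorm p -> 0 <= p x.
Proof. by move=> sp; have := sp.1 x (- x); rewrite subrr seminorm0 // seminormN //; lra. Qed.

Lemma seminormB p x y : seminorm p -> p x - p y <= p (x - y).
Proof. by move=> sp; have := sp.1 (x - y) y; rewrite subrK; lra. Qed.

Lemma seminorm_convex p : seminorm p -> convex_fun p.
Proof.
move=> sp x y t /andP[t0 t1]; apply: le_trans (sp.1 _ _) _.
by rewrite !sp.2 !nr_io !ger0_norm ?subr_ge0.
Qed.

(** For [0 < s], this bounds by [s] the ball measure of noncompactness of the set where [p < s]. *)
Definition covered p := forall s h : R, 0 < h ->
  exists l : seq V, forall z, p z < s -> exists2 y, y \in l & nrm (z - y) <= s + h.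

Definition admissible p := [/\ seminorm p, forall x, p x <= nrm x & covered p].

Lemma admissible_nrm : admissible (@nrm _ _ V).
Proof.
split=> //; first exact: seminorm_nrm.
by move=> s h h0; exists [:: 0] => z zs; exists 0; rewrite ?inE // subr0; lra.
Qed.

(** [q z] is the infimum over scalars [c] of [p (z - c *: v) + th * |c|]. Where [q < s] only [c]
    with [|c| < s / th] matter, and a finite net of these preserves the covering property. *)
Lemma admissible_step th p v : 0 < th -> admissible p ->
  exists q, [/\ admissible q, forall x, q x <= p x & q v <= th].
Proof.
move=> th0 [sp pn pc].
have /choice [q qP] z : exists m, (forall c : K, setT c -> m <= p (z - c *: v) + th * nr c) /\
    (forall b, (forall c : K, setT c -> b <= p (z - c *: v) + th * nr c) -> b <= m).
  apply: (@inf_family _ _ _ _ 0); first by exists 0.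
  by move=> c _; rewrite addr_ge0 ?seminorm_ge0 // mulr_ge0 ?nr_ge0 // ltW.
have ql z c : q z <= p (z - c *: v) + th * nr c by exact: (qP z).1.
have qp z : q z <= p z by have := ql z 0; rewrite scale0r subr0 nr0 mulr0 addr0.
exists q; split=> //; last first.
  by have := ql v 1; rewrite scale1r subrr seminorm0 // nr1; lra.
split; [|by move=> x; exact: le_trans (qp x) (pn x)|]; last first.
- move=> s h h0; have [l lP] := pc s (h / 2) (divr_gt0 h0 (ltr0Sn _ _)).
  have m0 : 0 < h / (2 * (nrm v + 1)).
    by rewrite divr_gt0 // mulr_gt0 //; have := nrm_ge0 v; lra.
  have [cs csP] := @scalar_net R k (s / th) _ m0.
  exists [seq y + c *: v | y <- l, c <- cs] => z zs.
  have [c cs'] : exists c, p (z - c *: v) + th * nr c < s.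
    apply: contrapT => N; suff : s <= q z by lra.
    by apply: (qP z).2 => c _; rewrite leNgt; apply/negP => cs'; apply: N; exists c.
  have [|y yl yz] := lP (z - c *: v).
    by have := mulr_ge0 (ltW th0) (nr_ge0 c); lra.
  have [|b bcs cb] := csP c.
    by rewrite ler_pdivlMr // mulrC; have := seminorm_ge0 (z - c *: v) sp; lra.
  exists (y + b *: v); first by apply/allpairsP; exists (y, b).
  have -> : z - (y + b *: v) = (z - c *: v - y) + (c - b) *: v.
    by rewrite scalerBl [z - _ - y]addrAC opprD !addrA subrK.
  apply: le_trans (nrmD _ _) _; rewrite nrmZ.
  suff : nr (c - b) * nrm v <= h / 2 by lra.
  have mE : h / (2 * (nrm v + 1)) * (2 * (nrm v + 1)) = h.
    by rewrite divfK // mulf_neq0 // gt_eqF //; have := nrm_ge0 v; lra.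
  by have := ler_wpM2r (nrm_ge0 v) cb; move: m0 mE; lra.
apply: seminorm_of_le => [x y|a x].
  rewrite -lerBlDr; apply: (qP x).2 => c _; rewrite lerBlDr -lerBlDl.
  apply: (qP y).2 => c' _; rewrite lerBlDl; apply: le_trans (ql (x + y) (c + c')) _.
  rewrite scalerDl opprD addrACA.
  have := sp.1 (x - c *: v) (y - c' *: v); have : nr (c + c') <= nr c + nr c'.
    by rewrite -(@ler_io R k) ioD !io_nr ler_normD.
  by move=> /(ler_wpM2l (ltW th0)); lra.
have [->|a0] := eqVneq a 0.
  by rewrite scale0r nr0 mul0r; apply: le_trans (qp _) _; rewrite seminorm0.
have na0 : 0 < nr a.
  by rewrite lt_def nr_ge0 andbT; apply: contra_neq a0; exact: nr0_eq0.
rewrite -ler_pdivrMl //; apply: (qP x).2 => c _; rewrite ler_pdivrMl //.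
apply: le_trans (ql _ (a * c)) _; rewrite -scalerA -scalerBr sp.2 nrM; lra.
Qed.

(** As the sequence decreases, a vector [x n] once made short stays short for all later
    seminorms. *)
Lemma seminorm_sequence (x : nat -> V) th : 0 < th -> exists d : nat -> V -> R,
  [/\ forall n, admissible (d n), forall n m z, (n <= m)%N -> d m z <= d n z &
      forall n, d n.+1 (x n) <= th].
Proof.
move=> th0; have /choice [step stepP] (pv : (V -> R) * V) : exists q, admissible pv.1 ->
    [/\ admissible q, forall z, q z <= pv.1 z & q pv.2 <= th].
  have [pa|?] := pselect (admissible pv.1); last by exists pv.1.
  by have [q qP] := @admissible_step th pv.1 pv.2 th0 pa; exists q.
pose fix d n := if n is n'.+1 then step (d n', x n') else @nrm _ _ V.
have da n : admissible (d n).
  elim: n => [|n IH]; first exact: admissible_nrm.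
  by have [] := stepP (d n, x n) IH.
have dS n := stepP (d n, x n) (da n).
exists d; split=> // [n m z|n]; last by have [_ _] := dS n.
move=> /subnK <-; elim: (m - n)%N => // j IH.
by have [_ h _] := dS (j + n)%N; apply: le_trans (h z) IH.
Qed.

Lemma seminorm_sum p q t : 0 <= t -> seminorm p -> seminorm q -> seminorm (fun z => p z + t * q z).
Proof.
move=> t0 [pD pZ] [qD qZ]; split=> [x y|a x]; last by rewrite pZ qZ; ring.
by have := ler_wpM2l t0 (qD x y); have := pD x y; lra.
Qed.

(** [N] is the norm plus the series of [c n * d n], with weights of sum 1. The last clause allows a
    single term to be split off while the rest remains a seminorm. *)
Lemma seminorm_series (d : nat -> V -> R) : (forall n, seminorm (d n)) ->
  (forall n x, d n x <= nrm x) ->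
  exists (N : V -> R) (c : nat -> R), [/\ seminorm N, forall x, nrm x <= N x <= 2 * nrm x,
    forall n, 0 < c n & forall n, seminorm (fun z => N z - c n * d n z)].
Proof.
move=> sd dn; pose c n : R := 2^-1 ^+ n.+1.
have c0 n : 0 < c n by rewrite exprn_gt0 // invr_gt0.
pose fix S n := if n is n'.+1 then fun z => S n' z + c n' * d n' z else @nrm _ _ V.
have dc n z : 0 <= c n * d n z by rewrite mulr_ge0 ?seminorm_ge0 // ltW.
have S2 n z : S n z <= (2 - 2^-1 ^+ n) * nrm z.
  elim: n => [|n IH] /=; first by rewrite expr0; have := nrm_ge0 z; lra.
  have := ler_wpM2l (ltW (c0 n)) (dn n z); rewrite /c exprS; move: IH; lra.
have sS n : seminorm (S n).
  by elim: n => [|n IH] /=; [exact: seminorm_nrm|apply: seminorm_sum => //; exact: ltW].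
have Smono n m z : (n <= m)%N -> S n z <= S m z.
  move=> /subnK <-; elim: (m - n)%N => // j IH; apply: le_trans IH _.
  by rewrite addSn /= lerDl.
have /choice [N NP] z : exists b, (forall n, setT n -> S n z <= b) /\
    (forall b', (forall n, setT n -> S n z <= b') -> b <= b').
  apply: (@sup_family _ _ _ (fun n => S n z) (2 * nrm z)); first by exists 0%N.
  move=> n _; apply: le_trans (S2 n z) _; rewrite ler_wpM2r ?nrm_ge0 //.
  by rewrite gerBl exprn_ge0 // invr_ge0.
have SN n z : S n z <= N z by exact: (NP z).1.
have tail n j : seminorm (fun z => S (j + n.+1)%N z - c n * d n z).
  elim: j => [|j IH].
    suff -> : (fun z => S (0 + n.+1)%N z - c n * d n z) = S n by [].
    by apply/funext => z /=; rewrite addrK.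
  have := seminorm_sum (ltW (c0 (j + n.+1)%N)) IH (sd (j + n.+1)%N).
  by congr seminorm; apply/funext => z; rewrite addSn /= addrAC.
have sN : seminorm N.
  apply: seminorm_of_le => [x y|a x]; apply: (NP _).2 => n _.
    by apply: le_trans ((sS n).1 x y) _; apply: lerD.
  by rewrite (sS n).2 ler_wpM2l ?nr_ge0.
exists N, c; split=> // [x|n].
  rewrite (SN 0%N x) /=; apply: (NP x).2 => n _; apply: le_trans (S2 n x) _.
  by rewrite ler_wpM2r ?nrm_ge0 // gerBl exprn_ge0 // invr_ge0.
split=> [x y|a x]; last by rewrite sN.2 (sd n).2; ring.
rewrite lerBlDr; apply: (NP _).2 => m _.
apply: le_trans (Smono m (m + n.+1)%N _ (leq_addr _ _)) _.
have := (tail n m).1 x y; have := SN (m + n.+1)%N x; have := SN (m + n.+1)%N y; lra.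
Qed.

(** [N] is the Minkowski functional of [U]. As [U] may fail to be closed, only [N x < 1] returns [x]
    to [U]. *)
Lemma gauge (U : set V) r M : 0 < r -> econvex U -> balanced U ->
  (forall x, nrm x <= r -> U x) -> (forall x, U x -> nrm x <= M) ->
  exists N : V -> R, [/\ seminorm N, forall x, nrm x <= M * N x, forall x, N x <= r^-1 * nrm x,
    forall x, U x -> N x <= 1 & forall x, N x < 1 -> U x].
Proof.
move=> r0 cU bU rU UM.
have M0 : 0 <= M by apply: le_trans (UM 0 (rU 0 _)); rewrite nrm0 // ltW.
pose P z := [set t : R | 0 < t /\ U (io t^-1 *: z)].
have Pr z e : 0 < e -> P z (r^-1 * nrm z + e).
  move=> e0; have n0 := mulr_ge0 (ltW (mulr_gt0 r0 r0)) (nrm_ge0 z).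
  have t0 : 0 < r^-1 * nrm z + e by rewrite ltr_wpDl // mulr_ge0 ?nrm_ge0 // invr_ge0 ltW.
  split=> //; apply: rU; rewrite nrmZ nr_io gtr0_norm ?invr_gt0 // ler_pdivrMl //.
  by rewrite mulrDl mulrAC mulVf ?gt_eqF // mul1r lerDl mulr_ge0 // ltW.
have /choice [N NP] z : exists m, (forall t, P z t -> m <= t) /\
    (forall b, (forall t, P z t -> b <= t) -> b <= m).
  apply: (@inf_family _ _ (P z) id 0); first by exists (r^-1 * nrm z + 1); exact: Pr.
  by move=> t [/ltW].
have Nle z t : 0 < t -> U (io t^-1 *: z) -> N z <= t by move=> t0 Ut; apply: (NP z).1.
have Nr x : N x <= r^-1 * nrm x.
  by apply/ler_addgt0Pr => e e0; have [] := Pr x e e0; exact: Nle.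
have N1 x : N x < 1 -> U x.
  move=> Nx; have [t [t0 Ut] t1] : exists2 t, P x t & t < 1.
    apply: contrapT => F; suff : 1 <= N x by lra.
    by apply: (NP x).2 => t Pt; rewrite leNgt; apply/negP => t1; apply: F; exists t.
  have -> : x = io t *: (io t^-1 *: x) by rewrite scalerA -ioM divff ?gt_eqF // io1 scale1r.
  by apply: bU => //; rewrite nr_io gtr0_norm // ltW.
exists N; split=> //; first last.
- by move=> x Ux; apply: Nle => //; rewrite invr1 io1 scale1r.
- move=> x; have [M00|M0'] := eqVneq M 0.
    have [_ /UM] := Pr x 1 ltr01; rewrite nrmZ nr_io M00 mul0r.
    have t0 : 0 < r^-1 * nrm x + 1 by rewrite ltr_wpDl // mulr_ge0 ?nrm_ge0 // invr_ge0 ltW.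
    by rewrite ger0_norm ?invr_ge0 ?(ltW t0) // ler_pdivrMl // mulr0.
  have {}M0 : 0 < M by rewrite lt_def M0'.
  rewrite -ler_pdivrMl //; apply: (NP x).2 => t [t0 /UM].
  by rewrite nrmZ nr_io gtr0_norm ?invr_gt0 // !ler_pdivrMl // mulrC.
apply: seminorm_of_le => [x y|a x].
  rewrite -lerBlDr; apply: (NP x).2 => t [t0 Ut]; rewrite lerBlDr -lerBlDl.
  apply: (NP y).2 => s [s0 Us]; rewrite lerBlDl.
  have ts0 : 0 < t + s by exact: addr_gt0.
  apply: Nle => //; have -> : io (t + s)^-1 *: (x + y) =
      io (t / (t + s)) *: (io t^-1 *: x) + io (1 - t / (t + s)) *: (io s^-1 *: y).
    rewrite !scalerA -!ioM scalerDr; congr (io _ *: _ + io _ *: _); field.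
      by rewrite !gt_eqF.
    by rewrite !gt_eqF.
  apply: cU => //; rewrite divr_ge0 ?(ltW t0) ?(ltW ts0) //= ler_pdivrMr // mul1r lerDl ltW //.
have [->|a0] := eqVneq a 0.
  by rewrite scale0r nr0 mul0r; apply: le_trans (Nr _) _; rewrite nrm0 mulr0.
have na0 : 0 < nr a.
  by rewrite lt_def nr_ge0 andbT; apply: contra_neq a0; exact: nr0_eq0.
rewrite -ler_pdivrMl //; apply: (NP x).2 => t [t0 Ut]; rewrite ler_pdivrMl //.
apply: Nle; first exact: mulr_gt0.
have -> : io (nr a * t)^-1 *: (a *: x) = (a * io (nr a)^-1) *: (io t^-1 *: x).
  by rewrite !scalerA invfM ioM; congr (_ *: _); ring.
by apply: bU => //; rewrite nrM nr_io gtr0_norm ?invr_gt0 // divff ?gt_eqF.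
Qed.

Lemma seminorm_equivalent N c C : seminorm N -> 0 < c -> 0 < C ->
  (forall x, c * nrm x <= N x) -> (forall x, N x <= C * nrm x) ->
  exists E : equivalent_norm V, forall x, E x = io (N x).
Proof.
move=> sN c0 C0 cN NC.
have ND x y : io (N (x + y)) <= io (N x) + io (N y) by rewrite -ioD ler_io sN.1.
have NZ a x : io (N (a *: x)) = `|a| * io (N x) by rewrite sN.2 ioM io_nr.
have N0 x : io (N x) = 0 -> x = 0.
  move=> /(congr1 (@re R k)); rewrite ioK re0 => Nx; apply: nrm0_eq0; apply/eqP.
  by rewrite eq_le nrm_ge0 andbT -(pmulr_rle0 _ c0) -Nx.
have NE : exists c C : K, [/\ 0 < c, 0 < C & forall x, c * `|x| <= io (N x) /\ io (N x) <= C * `|x| ].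
  exists (io c), (io C); rewrite -io0 !ltr_io; split=> // x.
  by rewrite -io_nrm -!ioM !ler_io.
by exists (EquivalentNorm ND NZ N0 NE).
Qed.

End Seminorms.

(** * The renormings *)

Section Counterexample.
Variables (R : realType) (k : scalars).
Local Notation K := (scalar_field R k).
Local Notation io := (@io R k).

Lemma nondentable_set (V : normedModType K) : ~ RNP V -> exists (A : set V) (M d : R),
  [/\ A !=set0, forall x, A x -> nrm x <= M, 0 < d &
    forall a, A a -> hull (A `\` [set b | nrm (b - a) < d]) a].
Proof.
move=> /existsNP[A] /not_implyP[A0] /not_implyP[/bounded_setP[M _ AM]].
move=> /existsNP[d'] /not_implyP[/gt0_ioP[d d0 ->]] /forall2NP Ad.
exists A, M, d; split=> // a Aa; have [|/contrapT] := Ad a; first by [].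
rewrite hullE; suff <- : [set b | `|b - a| < io d] = [set b | nrm (b - a) < d] by [].
by apply/funext => b /=; rewrite -io_nrm ltr_io.
Qed.

Lemma renorming_nrm (V : normedModType K) (E : equivalent_norm V) (N : V -> R) :
  (forall x, E x = io (N x)) -> forall x : renorming E, nrm x = N x.
Proof. by move=> EN x; rewrite /nrm renorming_normE EN ioK. Qed.

(** The points where the infimum of the [d n] is at most [th] form a closed balanced set; it is
    convex because the sequence decreases, so one index serves two points. *)
Lemma abs_hull_admissible (V : normedModType K) (x : nat -> V) (d : nat -> V -> R) th :
  (forall n, admissible (d n)) -> (forall n m z, (n <= m)%N -> d m z <= d n z) ->
  (forall n, d n.+1 (x n) <= th) -> 0 <= th ->
  forall c e, abs_hull (range x) c -> 0 < e -> exists n, d n c <= th + e.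
Proof.
move=> da dmono dx th0 c e + e0 => /(_ [set c | forall e, 0 < e -> exists n, d n c <= th + e]).
apply=> //.
- move=> u uP r r0 /=; have r2 : 0 < r / 2 by lra.
  have [a /(_ _ r2) [n dn] ua] := uP _ r2; exists n; have [sd dl _] := da n.
  by have := seminormB u a sd; have := dl (u - a); lra.
- move=> u v t uP vP t01 r r0 /=; have [n un] := uP r r0; have [m vm] := vP r r0.
  exists (maxn n m); have [sd _ _] := da (maxn n m).
  apply: (@sublevel_convex _ _ _ _ _ (seminorm_convex sd)) => //=.
    exact: le_trans (dmono _ _ _ (leq_maxl _ _)) un.
  exact: le_trans (dmono _ _ _ (leq_maxr _ _)) vm.
- move=> a u a1 uP r r0 /=; have [n un] := uP r r0; exists n; have [sd _ _] := da n.
  by rewrite sd.2; apply: le_trans un; exact: ler_piMl (seminorm_ge0 _ sd) a1.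
- by move=> _ [n _ <-] r r0; exists n.+1; have := dx n; lra.
Qed.

(* The unit ball of the first norm is [C + r B] and the second norm is
   [nrm + sum_n c_n p_n], where [p_n] is small near the absolutely convex
   combinations of the first points generating [C]. If [T] is near the identity
   and [u] in the closure of [T (C + r B)] has maximal norm, then some [p_n u] is
   small, while [C] is the closed convex hull of its points at which [p_n] is
   large; averaging over these contradicts maximality. *)
Lemma not_RNP_renorming (V : normedModType K) : ~ RNP V ->
  exists N1 N2 : equivalent_norm V, ~ dense_operators (QNA (renorming N1) (renorming N2)).
Proof.
move=> /nondentable_set[A [M [d [A0 AM d0 Ad]]]].
have [x [Ax xd]] := countable_nondentable A0 Ad.
pose C := abs_hull (range x).
have CM z : C z -> nrm z <= M.
  by apply: abs_hull_bounded => _ [i _ <-]; exact: AM.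
have C0 : C (x 0%N) by apply: sub_abs_hull; exists 0%N.
have M0 : 0 <= M := le_trans (nrm_ge0 _) (CM _ C0).
have Cbig : big_slices C (d / 2) by exact: abs_hull_big_slices.
(* Then [16 * r + d / 8 = d / 4] is below [d / 2], so the region where [p n < 16 * r] can be removed
   from [C]. *)
pose r := d / 128; have r0 : 0 < r by rewrite /r; lra.
have [p [pa pmono px]] := seminorm_sequence x r0.
have ps n : seminorm (p n) by have [] := pa n.
have pn n z : p n z <= nrm z by have [_ + _] := pa n; apply.
have Chull n : C `<=` hull (C `&` [set z | 16 * r <= p n z]).
  have [_ _ pc] := pa n; have d8 : 0 < d / 8 by lra.
  have [l lP] := pc (16 * r) (d / 8) d8.
  apply: (@hull_remove_balls _ _ _ _ _ M (d / 2) (16 * r + d / 8) l Cbig CM).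
    by rewrite /r; lra.
  by move=> z _ /negP; rewrite -ltNge => /lP.
have [N2 [c [sN2 N2n c0 rest]]] := seminorm_series ps pn.
pose U := [set z | exists a w, [/\ C a, nrm w <= r & z = a + w]].
have CU a w : C a -> nrm w <= r -> U (a + w) by move=> Ca wr; exists a, w.
have UM z : U z -> nrm z <= M + r.
  by move=> [a [w [/CM aM wr ->]]]; have := nrmD a w; lra.
have Cz0 : C 0 by rewrite -(scale0r (x 0%N)); apply: abs_hull_balanced; rewrite ?nr0.
have rU z : nrm z <= r -> U z by move=> zr; rewrite -[z]add0r; exact: CU.
have Uc : econvex U.
  move=> _ _ t [a [w [Ca wr ->]]] [a' [w' [Ca' wr' ->]]] t01.
  rewrite !scalerDr addrACA; apply: CU; first exact: abs_hull_convex.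
  by apply: (sublevel_convex (seminorm_convex (@seminorm_nrm _ _ V))).
have Ub : balanced U.
  move=> u _ u1 [a [w [Ca wr ->]]]; rewrite scalerDr; apply: CU; first exact: abs_hull_balanced.
  by rewrite nrmZ; apply: le_trans wr; exact: ler_piMl (nrm_ge0 _) u1.
have [N1 [sN1 N1M N1r UN1 N1U]] := gauge r0 Uc Ub rU UM.
have Mr0 : 0 < M + r by lra.
have [E1 E1E] : exists E : equivalent_norm V, forall z, E z = io (N1 z).
  apply: (@seminorm_equivalent _ _ _ N1 (M + r)^-1 r^-1) => //; rewrite ?invr_gt0 // => z.
  by rewrite ler_pdivrMl.
have [E2 E2E] : exists E : equivalent_norm V, forall z, E z = io (N2 z).
  apply: (@seminorm_equivalent _ _ _ N2 1 2) => // z; last by have /andP[] := N2n z.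
  by rewrite mul1r; have /andP[] := N2n z.
have n1 := renorming_nrm E1E; have n2 := renorming_nrm E2E.
exists E1, E2 => dense.
have [I IE] : exists I : {linear renorming E1 -> renorming E2}, forall z : V, I z = z.
  by apply: (@linear_pack R k (renorming E1) (renorming E2) id).
have Ib : bounded_operators I.
  apply/bounded_operatorsP; exists (2 * (M + r)); first by lra.
  move=> z; rewrite n1 n2 IE; have := N1M z; have /andP[_] := N2n z; lra.
have r0' : 0 < io r by rewrite -io0 ltr_io.
have [T [Tb [u uT um]] TI] := dense I Ib _ r0'.
have [B B0 TB] := (bounded_operatorsP T).1 Tb.
pose t : V -> V := T.
have tB z : N2 (t z) <= B * N1 z by have := TB z; rewrite n1 n2.
have tD (y z : V) : t (y + z) = t y + t z by exact: (linearD T).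
have tZ a (z : V) : t (a *: z) = a *: t z by exact: (linearZ_LR T).
have ballE (z : renorming E1) : unit_ball (renorming E1) z <-> N1 z <= 1.
  by rewrite /unit_ball /= -n1 -io_nrm -io1 ler_io.
have tmax z : N1 z <= 1 -> N2 (t z) <= N2 u.
  have [|e [Te eT _]] := @opnormP _ _ _ _ (T : renorming E1 -> renorming E2) B.
    by move=> y y1; apply: le_trans (TB y) _; exact: ler_piMr.
  move: um; rewrite Te -io_nrm => /(can_inj (@ioK R k)); rewrite n2 => -> z1.
  by have := eT z; rewrite n1 n2; exact.
have tI z : N1 z <= 1 -> N2 (z - t z) <= r.
  have [|e [Te eT _]] := @opnormP _ _ _ _ (I \- T : renorming E1 -> renorming E2) (2 * (M + r) + B).
    move=> y; rewrite n1 => y1 /=; rewrite n2 /= IE; apply: le_trans (sN2.1 _ _) _.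
    rewrite (seminormN _ sN2); apply: lerD; last by apply: le_trans (tB y) _; exact: ler_piMr.
    have /andP[_] := N2n y; have := N1M y; have := ler_wpM2l (ltW Mr0) y1; lra.
  move: TI; rewrite Te ltr_io => /ltW er z1; apply: le_trans er.
  by have := eT z; rewrite n1 n2 /= IE; exact.
(* Points of the closed unit ball of [N1] may lie outside [U], so they are first shrunk by
   [1 - s']. *)
have approx s : 0 < s -> exists2 z, U z & N2 (u - t z) <= s.
  move=> s0; have m0 : 0 < N2 u + 1 by have := seminorm_ge0 u sN2; lra.
  pose s' := Num.min 2^-1 (s / (2 * (N2 u + 1))).
  have s'0 : 0 < s' by rewrite lt_min invr_gt0 ltr0n /= divr_gt0 // mulr_gt0.
  have s'1 : s' <= 2^-1 by rewrite ge_min lexx.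
  have s's : s' * N2 u <= s / 2.
    have : s' * (2 * (N2 u + 1)) <= s by rewrite -ler_pdivlMr ?ge_min ?lexx ?orbT // mulr_gt0.
    by have := ltW s'0; lra.
  have [|_ [z /ballE z1 <-] uz] := (closureP _ _).1 uT (s / 2); first by lra.
  exists (io (1 - s') *: z).
    apply: N1U; rewrite sN1.2 nr_io gtr0_norm; last by lra.
    by have := ler_wpM2l (_ : 0 <= 1 - s') z1; lra.
  rewrite tZ ioB io1 scalerBl scale1r opprB addrCA addrC.
  apply: le_trans (sN2.1 _ _) _; rewrite sN2.2 nr_io gtr0_norm //.
  have := ler_wpM2l (ltW s'0) (tmax z z1); move: uz; rewrite n2 /=; lra.
have N1r1 z : U z -> N2 (z - t z) <= r by move=> /UN1; exact: tI.
have nN2 z : nrm z <= N2 z by have /andP[] := N2n z.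
have [_ [a1 [w1 [Ca1 w1r ->]]] ua1] := approx r r0.
have [n na1] : exists n, p n a1 <= r + r.
  have pS m : p m.+1 (x m) <= r by exact: px.
  exact: (abs_hull_admissible pa pmono pS (ltW r0) Ca1 r0).
(* Three moves of length at most [r], from [u] to [t (a1 + w1)], to [a1 + w1] and to [a1], plus
   [p n a1 <= 2 * r]. *)
have pu : p n u <= 5 * r.
  have := nN2 (u - t (a1 + w1)); have := nN2 (a1 + w1 - t (a1 + w1)).
  have := N1r1 _ (CU _ _ Ca1 w1r).
  have := nrm_triangle (t (a1 + w1)) u a1; have := nrm_triangle (a1 + w1) (t (a1 + w1)) a1.
  have -> : a1 + w1 - a1 = w1 by rewrite addrAC subrr add0r.
  rewrite [nrm (t _ - (_ + _))]nrm_distC.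
  have := seminormB u a1 (ps n); have := pn n (u - a1); lra.
pose q z := N2 z - c n * p n z; have sq : seminorm q by exact: rest.
have qN2 z : q z <= N2 z.
  have := mulr_ge0 (ltW (c0 n)) (seminorm_ge0 z (ps n)); rewrite /q; lra.
have cr0 : 0 < c n * r by rewrite mulr_gt0.
(* A second approximation of [u], made once [n] is known because its accuracy depends on [c n]. *)
have [_ [a [w [Ca wr ->]]] uaw] := approx (c n * r) cr0.
have qW z : C z -> 16 * r <= p n z -> q (t (z + w)) <= N2 u - c n * (14 * r).
  move=> Cz pz; have Uz := CU z w Cz wr; have := tmax _ (UN1 _ Uz).
  have : p n z - 2 * r <= p n (t (z + w)).
    have := seminormB z (t (z + w)) (ps n); have := pn n (z - t (z + w)).
    have := nrm_triangle (z + w) z (t (z + w)); have := nN2 (z + w - t (z + w)).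
    have -> : z - (z + w) = - w by rewrite opprD addrA subrr add0r.
    by rewrite nrmN; have := N1r1 _ Uz; lra.
  move=> pt; have : 14 * r <= p n (t (z + w)) by lra.
  by move=> /(ler_wpM2l (ltW (c0 n))); rewrite /q; lra.
(* With [w] fixed, the bound [qW] extends from the points where [p n] is large to their closed
   convex hull, which contains [a]. *)
have : q (t (a + w)) <= N2 u - c n * (14 * r).
  apply: (Chull n a Ca [set z | q (t (z + w)) <= N2 u - c n * (14 * r)]).
  - apply: (@sublevel_closed _ _ _ (fun z => q (t (z + w))) (B * r^-1)) => y z.
    have := seminormB (t (y + w)) (t (z + w)) sq.
    have -> : t (y + w) - t (z + w) = t (y - z).
      by rewrite !tD opprD addrACA subrr addr0 -[- t z]scaleN1r -tZ scaleN1r -tD.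
    have : q (t (y - z)) <= N2 (t (y - z)).
      exact: qN2.
    have := tB (y - z); have := ler_wpM2l B0 (N1r (y - z)); rewrite mulrA; lra.
  - apply: (@sublevel_convex _ _ _ (fun z => q (t (z + w)))) => y z s s01.
    have -> : t (io s *: y + io (1 - s) *: z + w) = io s *: t (y + w) + io (1 - s) *: t (z + w).
      rewrite -!tZ -tD; congr t; rewrite !scalerDr addrACA; congr (_ + _).
      by rewrite -scalerDl -ioD [s + _]addrC subrK io1 scale1r.
    exact: seminorm_convex.
  - by move=> z [Cz pz]; exact: qW.
(* Contradiction: [q u] is at least [N2 u - 5 * c n * r] by [pu], but at most [N2 u - 13 * c n * r]
   by approximation. *)
have := seminormB u (t (a + w)) sq.
have := qN2 (u - t (a + w)).
have := ler_wpM2l (ltW (c0 n)) pu.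
move: uaw cr0; rewrite /q; lra.
Qed.
End Counterexample.

(** * Density for renormings of a space with the RNP, and the equivalences *)

Section Renorming.
Variables (R : realType) (k : scalars).
Local Notation K := (scalar_field R k).
Local Notation io := (@io R k).
Variables (Z : completeNormedModType K) (N : equivalent_norm Z).

Lemma renorming_nrm_bounds : exists2 c, 0 <= c & forall x : Z,
  nrm (x : renorming N) <= c * nrm x /\ nrm x <= c * nrm (x : renorming N).
Proof.
have [c' [C' [/gt0_ioP[c c0 ->] /gt0_ioP[C C0 ->] NP]]] := en_equiv N.
have nE (x : renorming N) : io (nrm x) = N x by rewrite io_nrm renorming_normE.
exists (C + c^-1) => [|x]; first by exact: addr_ge0 (ltW C0) (ltW (etrans (invr_gt0 c) c0)).
have [] := NP x; rewrite -nE -io_nrm -!ioM !ler_io -ler_pdivlMl // => h1 h2.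
have := nrm_ge0 x; have := nrm_ge0 (x : renorming N); rewrite !mulrDl => N0 x0.
have := mulr_ge0 (ltW C0) N0.
have : 0 <= c^-1 * nrm x by rewrite mulr_ge0 ?nrm_ge0 // invr_ge0 ltW.
by split; lra.
Qed.

Lemma RNP_QNA_domain (Y : normedModType K) : RNP Z -> dense_operators (QNA (renorming N) Y).
Proof.
move=> rnp T Tb _ /gt0_ioP[e e0 ->]; have [c c0 cN] := renorming_nrm_bounds.
have [I IE] : exists I : {linear renorming N -> Z}, forall z : Z, I z = z.
  by apply: (@linear_pack R k (renorming N) Z id).
have [J JE] : exists J : {linear Z -> Y}, forall z : Z, J z = T z.
  by apply: (@linear_pack R k Z Y T) => a x y; exact: (linearP T).
apply: (@QNA_approximation _ _ _ _ _ I J) => //; last by move=> x; rewrite JE IE.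
  by apply/bounded_operatorsP; exists c => // x; rewrite IE; have [] := cN x.
have [M M0 TM] := (bounded_operatorsP T).1 Tb.
apply/bounded_operatorsP; exists (M * c); first exact: mulr_ge0.
move=> x; rewrite JE -mulrA; apply: le_trans (TM x) _; rewrite ler_wpM2l //.
by have [] := cN x.
Qed.

Lemma RNP_QNA_codomain (X : normedModType K) : RNP Z -> dense_operators (QNA X (renorming N)).
Proof.
move=> rnp T Tb _ /gt0_ioP[e e0 ->]; have [c c0 cN] := renorming_nrm_bounds.
have [I IE] : exists I : {linear Z -> renorming N}, forall z : Z, I z = z.
  by apply: (@linear_pack R k Z (renorming N) id).
have [J JE] : exists J : {linear X -> Z}, forall x, J x = T x.
  by apply: (@linear_pack R k X Z T) => a x y; exact: (linearP T).
apply: (@QNA_approximation _ _ _ _ _ J I) => //; last by move=> x; rewrite IE JE.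
  have [M M0 TM] := (bounded_operatorsP T).1 Tb.
  apply/bounded_operatorsP; exists (c * M); first exact: mulr_ge0.
  move=> x; rewrite JE -mulrA; have [_ h] := cN (T x); apply: le_trans h _.
  by rewrite ler_wpM2l.
by apply/bounded_operatorsP; exists c => // x; rewrite IE; have [] := cN x.
Qed.

End Renorming.

Theorem corollary3p8 (R : realType) (k : scalars)
    (Z : completeNormedModType (scalar_field R k)) :
  (RNP Z <->
     forall (Y : completeNormedModType (scalar_field R k))
            (N : equivalent_norm Z),
       dense_operators (QNA (renorming N) Y)) /\
  (RNP Z <->
     forall (X : completeNormedModType (scalar_field R k))
            (N : equivalent_norm Z),
       dense_operators (QNA X (renorming N))).
Proof.
split; split=> [rnp Y N|dense].
- exact: RNP_QNA_domain.
(* A renorming of [Z] is itself a Banach space: [N2] provides the space [Y] here, and [N1] provides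
   [X] in the last case. *)
- apply: contrapT => /not_RNP_renorming[N1 [N2]]; apply.
  exact: (dense (renorming N2 : completeNormedModType _) N1).
- exact: RNP_QNA_codomain.
- apply: contrapT => /not_RNP_renorming[N1 [N2]]; apply.
  exact: (dense (renorming N1 : completeNormedModType _) N2).
Qed.
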